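(* Let $f(z)=\sum_{n\ge0}a_nz^n\in\mathbb{Q}[[z]]$ be a power series that converges on the open unit disk, and write $d_n=\mathrm{den}(a_n)$. Then one of the following three statements holds: (1) $f(z)$ admits the unit circle as a natural boundary; (2) there is some $\beta>1$, depending only on $f$, such that for every set $S\subseteq\mathbb{N}$ of zero density, $\mathrm{lcm}\{d_i: i\le n,\ i\notin S\}>\beta^n$ for all sufficiently large $n$; (3) for every positive constant $C$, there exist a positive integer $n$, a nonzero integer-valued polynomial $P(z)$ of degree at most $n$, and coprime polynomials $u(z),v(z)$ of degree at most $n$ with $v(0)\ne0$ such that $$\mathrm{ord}\Big(\sum_{j\ge0}P(j)a_jz^j-u(z)/v(z)\Big)>Cn.$$
   Context: For a rational number (or algebraic number) $\alpha$, $\mathrm{den}(\alpha)$ is the smallest positive integer $d$ such that $d\alpha$ is an (algebraic) integer. A set $S\subseteq\mathbb{N}$ has zero density if $\limsup_{n\to\infty}|S\cap[1,n]|/n=0$. A polynomial $P\in\mathbb{Q}[z]$ is integer-valued if $P(n)\in\mathbb{Z}$ for all $n\in\mathbb{Z}$. $f$ admits the unit circle as a natural boundary if $f$ cannot be analytically continued to a neighborhood of any point of the unit circle. For a Laurent/power series $g$, $\mathrm{ord}(g)$ is its order of vanishing at $z=0$, the rational function $u/v$ being expanded as a power series at $0$. *)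

(* Defs.v *)
From HB Require Import structures.
From mathcomp Require Import all_boot all_order all_algebra.
From mathcomp Require Import all_classical all_reals all_analysis.
From mathcomp Require Import complex.

Set Implicit Arguments.
Unset Strict Implicit.
Unset Printing Implicit Defensive.

Import Order.TTheory GRing.Theory Num.Theory.
Import numFieldNormedType.Exports.

Local Open Scope classical_set_scope.
Local Open Scope ring_scope.

Lemma den_exists (q : rat) :
  exists d : nat, (0 < d)%N && (d%:R * q \is a Num.int).
Proof.
exists `|denq q|%N; rewrite absz_gt0 denq_neq0 /=.
by rewrite pmulrn gez0_abs ?denq_ge0// mulrC -numqE intr_int.
Qed.

Definition den (q : rat) : nat := ex_minn (den_exists q).

Lemma denE (q : rat) : den q = `|denq q|%N.
Proof.
rewrite /den; case: ex_minnP => d /andP[d0 dq] dmin.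
apply/eqP; rewrite eqn_leq; apply/andP; split.
  apply: dmin; rewrite absz_gt0 denq_neq0 /=.
  by rewrite pmulrn gez0_abs ?denq_ge0// mulrC -numqE intr_int.
apply: dvdn_leq => //.
have /intrP[m Em] := dq.
have E : (numq q * d%:Z = m * denq q)%R.
  apply: (@intr_inj rat); rewrite !intrM numqE mulrAC -Em.
  by rewrite [q * _]mulrC pmulrn.
rewrite -(@Gauss_dvdr _ `|numq q|%N); last first.
  by rewrite coprime_sym coprime_num_den.
by apply/dvdnP; exists `|m|%N; move/(congr1 absz): E; rewrite !abszM.
Qed.

Definition zero_density (R : realType) (S : set nat) : Prop :=
  limn_esup (fun n : nat =>
    ((\sum_(1 <= i < n.+1 | i \in S) 1)%N%:R / n%:R : R)%:E) = 0%E.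

Definition integer_valued (P : {poly rat}) : Prop :=
  forall m : int, P.[m%:~R] \is a Num.int.

(* [R[i]] only receives its topology as a [numFieldType], hence this name for
   the complex field; the analytic definitions below are over any [K] and are
   meant for [K = complexes R]. *)
Definition complexes (R : realType) : numFieldType := R[i].

Definition complex_coefs (R : realType) (a : nat -> rat) : nat -> complexes R :=
  fun k => ratr (a k).

Definition power_series (K : numFieldType) (c : nat -> K) (z : K) : nat -> K :=
  series (fun k => c k * z ^+ k).

Definition sum_fun (K : numFieldType) (c : nat -> K) (z : K) : K :=
  limn (power_series c z).

Definition analytic_at (K : numFieldType) (g : K -> K) (w : K) : Prop :=
  exists (c : nat -> K) (r : K), 0 < r /\
    forall z, `|z - w| < r -> power_series c (z - w) @ \oo --> g z.

(* [f], given on the open unit disk, extends analytically to some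
   neighborhood of [w]. *)
Definition continuable_at (K : numFieldType) (f : K -> K) (w : K) : Prop :=
  exists (U : set K) (g : K -> K),
    [/\ open U, U w, (forall z, U z -> analytic_at g z)
      & forall z, U z -> `|z| < 1 -> g z = f z].

Definition unit_circle_natural_boundary (K : numFieldType) (f : K -> K) :
    Prop :=
  forall w : K, `|w| = 1 -> ~ continuable_at f w.

(* The order of vanishing of [\sum_k g k z^k] at 0; it is [+oo] for g = 0. *)
Definition ord (R : realType) (g : nat -> rat) : \bar R :=
  ereal_inf [set (k%:R : R)%:E | k in [set k : nat | g k != 0]].

(* The k-th coefficient of the expansion at 0 of
   u / v = (u / v(0)) * \sum_i (1 - v / v(0))^i, for v(0) != 0: since
   1 - v / v(0) vanishes at 0, only the terms with i <= k contribute. *)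
Definition quot_series (u v : {poly rat}) (k : nat) : rat :=
  (v.[0]^-1 *: (u * \sum_(i < k.+1) (1 - v.[0]^-1 *: v) ^+ i))`_k.

Lemma coef_expr_lt (q : {poly rat}) (i k : nat) :
  q.[0] = 0 -> (k < i)%N -> (q ^+ i)`_k = 0.
Proof.
move=> q0 ki; have /factor_theorem[p ->] : root q 0 by apply/rootP.
by rewrite subr0 exprMn coefMXn ki.
Qed.

Lemma quot_seriesP (u v : {poly rat}) : v.[0] != 0 ->
  forall k, \sum_(i < k.+1) v`_i * quot_series u v (k - i)%N = u`_k.
Proof.
move=> v0 k; set q := 1 - v.[0]^-1 *: v.
have q0 : q.[0] = 0 by rewrite !hornerE mulVf// subrr.
pose T m := v.[0]^-1 *: (u * \sum_(i < m) q ^+ i).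
have TE j : (j <= k)%N -> quot_series u v j = (T k.+1)`_j.
  move=> jk; rewrite /quot_series -/q /T !coefZ; congr (_ * _).
  rewrite !coefM; apply: eq_bigr => i _; congr (_ * _).
  rewrite -!(big_mkord xpredT (fun i => q ^+ i)).
  rewrite [in RHS](@big_cat_nat _ _ _ j.+1) ?ltnS//= coefD.
  rewrite [X in _ + X]coef_sum [X in _ + X]big_nat_cond.
  rewrite [X in _ + X]big1 ?addr0// => m /andP[/andP[jm _] _].
  by apply: coef_expr_lt => //; apply: leq_ltn_trans jm; exact: leq_subr.
transitivity ((v * T k.+1)`_k).
  by rewrite coefM; apply: eq_bigr => i _; rewrite TE// leq_subr.
have -> : v * T k.+1 = u * (1 - q ^+ k.+1).
  have -> : 1 - q ^+ k.+1 = (1 - q) * \sum_(i < k.+1) q ^+ i.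
    rewrite -{1}(expr1n _ k.+1) subrXX; congr (_ * _).
    by apply: eq_bigr => i _; rewrite expr1n mul1r.
  by rewrite /T /q subKr -scalerAr -!scalerAl -scalerAr mulrCA.
rewrite mulrBr mulr1 coefB coefM big1 ?subr0// => i _.
by rewrite coef_expr_lt ?mulr0// ltnS leq_subr.
Qed.

(* Main.v *)
(* Suppose that f = sum a_j z^j continues analytically across a point w of the
   unit circle. For small e > 0 there is a polynomial map
   phi(y) = rho y (1 + e T(y)) with rho > 1 sending the closed unit disk into
   the domain of f: it bulges out of the disk near w only. Hence f o phi has
   bounded Taylor coefficients, and by Lagrange inversion the coefficient of
   z^(ks+t) in Q^s f, where Q = 1 + e k T, decays like theta^s for some
   theta < 1. The same holds, with a loss B^deg(P), for the twist
   sum P(j) a_j z^j, which is P(z d/dz) f. Row and column operations by powers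
   of Q turn this into a bound theta^(n^2/2k) for the Hankel determinants of
   order n of the sequence P(j) a_j.

   If moreover the least common multiples of the denominators outside some S of
   zero density are at most l^N for infinitely many N, with l close to 1, then
   Siegel's lemma gives an integer-valued P of degree at most N/h', with small
   coordinates in the binomial basis, vanishing on the elements of S up to N.
   The Hankel determinants of P(j) a_j of all orders between a small multiple
   of N and N/2 have a small common denominator, and vanish since clearing it
   leaves integers smaller than 1. By Kronecker's argument sum P(j) a_j z^j
   agrees up to order N/2 with a rational function whose degree is a small
   multiple of N. *)

Require Import Defs.
From HB Require Import structures.
From mathcomp Require Import all_boot all_order all_algebra.
From mathcomp Require Import all_classical all_reals all_analysis.
From mathcomp Require Import perm cyclic separable cyclotomic.
From mathcomp Require Import complex ring lra zify.

Set Implicit Arguments.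
Unset Strict Implicit.
Unset Printing Implicit Defensive.

Import Order.TTheory GRing.Theory Num.Theory.
Import numFieldNormedType.Exports.
Import ComplexField.Normc.

Local Open Scope classical_set_scope.
Local Open Scope ring_scope.

(** * Weighted norms of complex polynomials *)

Section ComplexNorm.
Variable R : realType.
Implicit Types (z w : R[i]) (p q : {poly R[i]}) (r : R).

Lemma normc_ge0 z : 0 <= normc z.
Proof. by case: z => a b; exact: sqrtr_ge0. Qed.

Lemma normc_0 : normc (0 : R[i]) = 0.
Proof. exact: normc0. Qed.

Lemma normc_1 : normc (1 : R[i]) = 1.
Proof. exact: normc1. Qed.

Lemma normr_normc z : `|z| = (normc z)%:C%C.
Proof. by rewrite normc_def; case: z. Qed.

Lemma normc_le z r : (normc z <= r) = (`|z| <= r%:C%C).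
Proof. by rewrite normr_normc lecR. Qed.

Lemma normc_lt z r : (normc z < r) = (`|z| < r%:C%C).
Proof. by rewrite normr_normc ltcR. Qed.

Lemma normcX z n : normc (z ^+ n) = normc z ^+ n.
Proof. by elim: n => [|n IH]; rewrite ?expr0 ?normc_1// !exprS normcM IH. Qed.

Lemma normc_real r : normc (r%:C%C) = `|r|.
Proof. by rewrite /= expr0n /= addr0 sqrtr_sqr. Qed.

Lemma normc_nat n : normc (n%:R : R[i]) = n%:R.
Proof.
by apply: complexI; have := normr_nat R[i] n; rewrite normr_normc rmorph_nat.
Qed.

Lemma ler_normc_sum (I : Type) (s : seq I) (P : pred I) (F : I -> R[i]) :
  normc (\sum_(i <- s | P i) F i) <= \sum_(i <- s | P i) normc (F i).
Proof.
elim/big_ind2: _ => [|x1 x2 y1 y2 h1 h2|//]; first by rewrite normc_0.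
by apply: le_trans (le_normcD _ _) _; rewrite lerD.
Qed.

Lemma normc_prod (I : Type) (s : seq I) (P : pred I) (F : I -> R[i]) :
  normc (\prod_(i <- s | P i) F i) = \prod_(i <- s | P i) normc (F i).
Proof. by rewrite (big_morph _ (@normcM R) normc_1). Qed.

Lemma Re_le_normc z : complex.Re z <= normc z.
Proof.
case: z => a b /=; apply: le_trans (ler_norm _) _; rewrite -sqrtr_sqr.
by rewrite ler_wsqrtr// lerDl sqr_ge0.
Qed.

Lemma normc_sqE z : normc z ^+ 2 = complex.Re z ^+ 2 + complex.Im z ^+ 2.
Proof. by case: z => a b /=; rewrite sqr_sqrtr// addr_ge0 ?sqr_ge0. Qed.

Local Arguments normc : simpl never.

(** A majorant of the sup norm on the disk of radius r that also controls products and composites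
    ([wnormM], [wnorm_comp]): estimates on maps of the disk become inequalities between sums of
    coefficients. *)
Definition wnorm r p : R := \sum_(i < size p) normc p`_i * r ^+ i.

Lemma wnormE n r p : (size p <= n)%N ->
  wnorm r p = \sum_(i < n) normc p`_i * r ^+ i.
Proof.
move=> pn; rewrite /wnorm (big_ord_widen n (fun i => normc p`_i * r ^+ i))//.
rewrite big_mkcond; apply: eq_bigr => i _; case: ltnP => // h.
by rewrite nth_default// normc_0 mul0r.
Qed.

Lemma wnorm_ge0 r p : 0 <= r -> 0 <= wnorm r p.
Proof. by move=> r0; apply: sumr_ge0 => i _; rewrite mulr_ge0 ?normc_ge0 ?exprn_ge0. Qed.

Lemma wnorm0 r : wnorm r 0 = 0.
Proof. by rewrite /wnorm size_poly0 big_ord0. Qed.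

Lemma wnormC r c : wnorm r c%:P = normc c.
Proof.
by rewrite (@wnormE 1) ?size_polyC_leq1// big_ord1 expr0 mulr1 coefC.
Qed.

Lemma wnorm1 r : wnorm r 1 = 1.
Proof. by rewrite -polyC1 wnormC normc_1. Qed.

Lemma wnormXM r p : wnorm r ('X * p) = r * wnorm r p.
Proof.
rewrite (@wnormE (size p).+1); last first.
  by rewrite (leq_trans (size_polyMleq _ _))// size_polyX.
rewrite big_ord_recl coefXM /= normc_0 mul0r add0r mulr_sumr.
by apply: eq_bigr => i _; rewrite coefXM /= exprS; ring.
Qed.

Lemma wnormX r : wnorm r 'X = r.
Proof. by rewrite -[X in wnorm r X]mulr1 wnormXM wnorm1 mulr1. Qed.

Lemma wnormXnM r n p : wnorm r ('X^n * p) = r ^+ n * wnorm r p.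
Proof.
elim: n => [|n IH]; first by rewrite !expr0 !mul1r.
by rewrite !exprS -mulrA wnormXM IH mulrA.
Qed.

Lemma wnormZ r c p : wnorm r (c *: p) = normc c * wnorm r p.
Proof.
rewrite (@wnormE (size p)) ?size_scale_leq// mulr_sumr.
by apply: eq_bigr => i _; rewrite coefZ normcM mulrA.
Qed.

Lemma wnormN r p : wnorm r (- p) = wnorm r p.
Proof.
rewrite /wnorm size_polyN; apply: eq_bigr => i _; by rewrite coefN normcN.
Qed.

Lemma wnormD r p q : 0 <= r -> wnorm r (p + q) <= wnorm r p + wnorm r q.
Proof.
move=> r0; rewrite !(@wnormE (maxn (size p) (size q))) ?leq_maxl ?leq_maxr//.
  rewrite -big_split /=; apply: ler_sum => i _.
  by rewrite -mulrDl ler_wpM2r ?exprn_ge0// coefD le_normcD.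
exact: size_polyD.
Qed.

Lemma wnorm_sum r (I : Type) (s : seq I) (P : pred I) (F : I -> {poly R[i]}) :
  0 <= r -> wnorm r (\sum_(i <- s | P i) F i) <= \sum_(i <- s | P i) wnorm r (F i).
Proof.
move=> r0; elim/big_ind2: _ => [|x1 x2 y1 y2 h1 h2|//]; first by rewrite wnorm0.
by apply: le_trans (wnormD _ _ r0) _; rewrite lerD.
Qed.

Lemma poly_mulE p q : p * q = \sum_(i < size p) p`_i *: ('X^i * q).
Proof.
rewrite -[p in LHS]coefK poly_def mulr_suml.
by apply: eq_bigr => i _; rewrite scalerAl.
Qed.

Lemma wnormM r p q : 0 <= r -> wnorm r (p * q) <= wnorm r p * wnorm r q.
Proof.
move=> r0; rewrite poly_mulE; apply: le_trans (wnorm_sum _ _ _ r0) _.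
rewrite [X in _ <= X * _]/wnorm mulr_suml; apply: ler_sum => i _.
by rewrite wnormZ wnormXnM mulrA.
Qed.

Lemma wnorm_exp r p n : 0 <= r -> wnorm r (p ^+ n) <= wnorm r p ^+ n.
Proof.
move=> r0; elim: n => [|n IH]; first by rewrite !expr0 wnorm1.
rewrite !exprS; apply: le_trans (wnormM _ _ r0) _.
by rewrite ler_wpM2l// wnorm_ge0.
Qed.

Lemma wnorm_comp r p q : 0 <= r -> wnorm r (p \Po q) <= wnorm (wnorm r q) p.
Proof.
move=> r0; rewrite comp_polyE; apply: le_trans (wnorm_sum _ _ _ r0) _.
by apply: ler_sum => i _; rewrite wnormZ ler_wpM2l ?normc_ge0// wnorm_exp.
Qed.

Lemma le_wnorm r s p : 0 <= r -> r <= s -> wnorm r p <= wnorm s p.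
Proof.
move=> r0 rs; apply: ler_sum => i _; rewrite ler_wpM2l ?normc_ge0//.
by rewrite lerXn2r// nnegrE (le_trans r0).
Qed.

Lemma normc_coef_le r p i : 0 <= r -> normc p`_i * r ^+ i <= wnorm r p.
Proof.
move=> r0; case: (ltnP i (size p)) => h; last first.
  by rewrite nth_default// normc_0 mul0r wnorm_ge0.
rewrite /wnorm (bigD1 (Ordinal h))//= lerDl sumr_ge0// => j _.
by rewrite mulr_ge0 ?normc_ge0 ?exprn_ge0.
Qed.

Lemma normc_horner_le r p z : normc z <= r -> normc p.[z] <= wnorm r p.
Proof.
move=> zr; rewrite horner_coef; apply: le_trans (ler_normc_sum _ _ _) _.
apply: ler_sum => i _; rewrite normcM normcX ler_wpM2l ?normc_ge0//.
by rewrite lerXn2r// nnegrE ?normc_ge0// (le_trans (normc_ge0 z)).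
Qed.

Lemma normc_coefM_le p q (m : nat) (K : R) : 0 <= K ->
  (forall i, (i <= m)%N -> normc q`_i <= K) ->
  normc (p * q)`_m <= wnorm 1 p * K.
Proof.
move=> K0 qK; rewrite coefM; apply: le_trans (ler_normc_sum _ _ _) _.
rewrite (@wnormE (maxn (size p) m.+1)) ?leq_maxl// mulr_suml.
rewrite (big_ord_widen (maxn (size p) m.+1)
  (fun i => normc (p`_i * q`_(m - i)))) ?leq_maxr//.
rewrite big_mkcond; apply: ler_sum => i _.
rewrite expr1n mulr1; case: ifP => _; last by rewrite mulr_ge0 ?normc_ge0.
by rewrite normcM ler_wpM2l ?normc_ge0// qK// leq_subr.
Qed.

(** The cofactor of [p - q] in p^n - q^n is a sum of n products of n - 1 factors; b >= 1 absorbs the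
    missing factor. *)
Lemma wnormX_subX r (p q : {poly R[i]}) (b : R) n : 0 <= r -> 1 <= b ->
  wnorm r p <= b -> wnorm r q <= b ->
  wnorm r (p ^+ n - q ^+ n) <= wnorm r (p - q) * (n%:R * b ^+ n).
Proof.
move=> r0 b1 pb qb; rewrite subrXX; apply: le_trans (wnormM _ _ r0) _.
rewrite ler_wpM2l ?wnorm_ge0//; apply: le_trans (wnorm_sum _ _ _ r0) _.
apply: (@le_trans _ _ (\sum_(i < n) b ^+ n)); last first.
  by rewrite sumr_const card_ord mulr_natl.
apply: ler_sum => i _; apply: le_trans (wnormM _ _ r0) _.
have b0 : 0 <= b by apply: le_trans b1.
have h1 := le_trans (wnorm_exp p (n.-1 - i) r0)
  (lerXn2r (n.-1 - i) (wnorm_ge0 p r0 : wnorm r p \is Num.nneg) b0 pb).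
have h2 := le_trans (wnorm_exp q i r0)
  (lerXn2r i (wnorm_ge0 q r0 : wnorm r q \is Num.nneg) b0 qb).
apply: (@le_trans _ _ (b ^+ (n.-1 - i) * b ^+ i)).
  by rewrite ler_pM// wnorm_ge0.
by rewrite -exprD ler_weXn2l//; have := ltn_ord i; lia.
Qed.

(** A Lipschitz bound in the inner polynomial, term by term from [wnormX_subX]. For constant [q1]
    and [q2] it bounds the variation of p between two points. *)
Lemma wnorm_comp_sub r (p q1 q2 : {poly R[i]}) (b : R) : 0 <= r -> 1 <= b ->
  wnorm r q1 <= b -> wnorm r q2 <= b ->
  wnorm r ((p \Po q1) - (p \Po q2)) <=
  wnorm r (q1 - q2) * ((size p)%:R * b ^+ size p * wnorm 1 p).
Proof.
move=> r0 b1 h1 h2; rewrite !comp_polyE -sumrB.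
apply: le_trans (wnorm_sum _ _ _ r0) _.
rewrite [wnorm 1 p]/wnorm mulr_sumr mulr_sumr; apply: ler_sum => i _.
rewrite -scalerBr wnormZ expr1n mulr1 mulrA [leRHS]mulrC.
rewrite ler_wpM2l ?normc_ge0//; apply: le_trans (wnormX_subX i r0 b1 h1 h2) _.
rewrite ler_wpM2l ?wnorm_ge0// ler_pM ?ler0n ?exprn_ge0 ?ler_nat//.
- exact: le_trans b1.
- exact: ltnW.
- by rewrite ler_weXn2l// ltnW.
Qed.

(** In characteristic 0, X^n - 1 is separable, so it has n distinct roots, and then one of them is
    primitive. *)
Lemma prim_root_exists n : (0 < n)%N -> exists z : R[i], n.-primitive_root z.
Proof.
move=> n0; have [s Es] := closed_field_poly_normal ('X^n - 1 : {poly R[i]}).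
rewrite (monicP _) ?monicXnsubC// scale1r in Es.
have s1 : all n.-unity_root s by apply/allP => z; rewrite -root_prod_XsubC -Es.
have sz : (n < (size s).+1)%N by rewrite -(size_prod_XsubC s id) -Es size_XnsubC.
have [|z _ zP] := hasP (has_prim_root n0 s1 _ sz); last by exists z.
by rewrite -separable_prod_XsubC -Es separable_Xn_sub_1// pnatr_eq0 -lt0n.
Qed.

(* Averaging over roots of unity of order larger than the degree extracts a
   coefficient exactly. *)
Lemma cauchy_estimate (p : {poly R[i]}) (s K : R) i : 0 <= s ->
  (forall y, normc y = s -> normc p.[y] <= K) -> normc p`_i * s ^+ i <= K.
Proof.
move=> s0 pK; set n := maxn (size p) i.+1.
have n0 : (0 < n)%N by rewrite leq_max orbT.
have [z zP] := prim_root_exists n0.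
have nz : normc z = 1.
  apply/eqP; rewrite -(@pexpr_eq1 _ _ n) ?normc_ge0// -normcX.
  by rewrite (prim_expr_order zP) normc_1.
have z0 : z != 0 by apply: contra_eqN nz => /eqP->; rewrite normc_0 eq_sym oner_eq0.
have key : \sum_(j < n) p.[s%:C%C * z ^+ j] * z ^- (j * i)
    = n%:R * (p`_i * s%:C%C ^+ i).
  transitivity (\sum_(j < n) \sum_(l < n)
      p`_l * s%:C%C ^+ l * (z ^+ l / z ^+ i) ^+ j).
    apply: eq_bigr => j _.
    rewrite (@horner_coef_wide _ n) ?leq_maxl// mulr_suml.
    apply: eq_bigr => l _; rewrite exprMn -!mulrA; congr (_ * (_ * _)).
    by rewrite exprMn -!exprM mulnC exprVn -exprM [(j * i)%N]mulnC.
  rewrite exchange_big /= (bigD1 (Ordinal (leq_maxr (size p) i.+1 : (i < n)%N)))//=.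
  rewrite divff ?expf_neq0// [X in X + _](_ : _ = n%:R * (p`_i * s%:C%C ^+ i)); last first.
    under eq_bigr do rewrite expr1n mulr1.
    by rewrite sumr_const card_ord mulr_natl.
  rewrite big1 ?addr0// => l li; rewrite -mulr_sumr.
  (* Both exponents are below n, so for l != i the ratio is an n-th root of unity other than 1 and
     its powers sum to 0. *)
  suff -> : \sum_(j < n) (z ^+ l / z ^+ i) ^+ j = 0 by rewrite mulr0.
  have ne : z ^+ l / z ^+ i - 1 != 0.
    rewrite subr_eq0; apply: contra li => /eqP h.
    apply/eqP/val_inj => /=; apply/eqP.
    have : z ^+ l == z ^+ i.
      by rewrite -[z ^+ l](divfK (expf_neq0 i z0)) h mul1r.
    rewrite (eq_prim_root_expr zP) !modn_small//.
    by rewrite leq_max ltnS leqnn orbT.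
  apply: (mulfI ne); rewrite mulr0 -subrX1 exprMn exprVn -!exprM.
  by rewrite ![(_ * n)%N]mulnC !exprM (prim_expr_order zP) !expr1n divr1 subrr.
have : normc (n%:R * (p`_i * s%:C%C ^+ i)) <= n%:R * K.
  rewrite -key; apply: le_trans (ler_normc_sum _ _ _) _.
  rewrite mulr_natl -[X in _ <= K *+ X]card_ord -sumr_const.
  apply: ler_sum => j _; rewrite normcM normcV normcX nz expr1n invr1 mulr1.
  by apply: pK; rewrite normcM normcX nz expr1n mulr1 normc_real ger0_norm.
rewrite !normcM normc_nat normcX normc_real (ger0_norm s0) ler_pM2l//.
by rewrite ltr0n.
Qed.

End ComplexNorm.

(** * Change of variable and Hankel determinants *)

Section Residue.
Variable F : numFieldType.
Implicit Types p q h V W : {poly F}.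

Lemma dvdXn_coef n p : ('X^n %| p) = [forall i : 'I_n, p`_i == 0].
Proof.
apply/idP/forallP => [/dvdpP[r ->] i|h].
  by rewrite coefMXn ltn_ord.
apply/dvdpP; exists (drop_poly n p).
rewrite -[LHS](poly_take_drop n) [take_poly n p](_ : _ = 0) ?add0r//.
apply/polyP => i; rewrite coef_take_poly coef0; case: ltnP => // ni.
exact/eqP/(h (Ordinal ni)).
Qed.

Lemma coef_modXnM n p q h i : 'X^n %| p - q -> (i < n)%N ->
  (p * h)`_i = (q * h)`_i.
Proof.
move=> pq ni; apply/eqP; rewrite -subr_eq0 -coefB -mulrBl.
have : 'X^n %| (p - q) * h by rewrite dvdp_mulr.
by rewrite dvdXn_coef => /forallP/(_ (Ordinal ni)).
Qed.

Lemma dvdp_expr1B d p n : d %| p - 1 -> d %| p ^+ n - 1.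
Proof. by move=> dp; rewrite subrX1 dvdp_mulr. Qed.

(** With z = y V(y) and dz = (V + y V') dy, this is the residue of z^(l-m-1) dz: 1 for l = m, where
    the form is a logarithmic derivative, and 0 otherwise, where it is exact. *)
Let residue_monomial V W (m l : nat) : V`_0 = 1 -> 'X^(m.+1) %| V * W - 1 ->
  ('X^l * (V ^+ l * (V + 'X * V^`()) * W ^+ m.+1))`_m = (l == m)%:R.
Proof.
move=> V0 VW; rewrite coefXnM; case: ltnP => [|lm]; first by case: ltngtP.
set j := (m - l)%N; have -> : m.+1 = (l + j.+1)%N by rewrite /j; lia.
rewrite exprD (_ : V ^+ l * _ * _ = (V * W) ^+ l * ((V + 'X * V^`()) * W ^+ j.+1)); last first.
  by rewrite exprMn; ring.
have jm : (j < m.+1)%N by rewrite ltnS leq_subr.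
rewrite (coef_modXnM _ (dvdp_expr1B l VW) jm) mul1r.
have W0 : W`_0 = 1.
  have := coef_modXnM 1 VW (ltn0Sn m); rewrite !mulr1 coefM big_ord1 V0 mul1r.
  by rewrite coef1.
case: (posnP j) => j0.
  have -> : l == m by rewrite eqn_leq lm -subn_eq0 -/j j0.
  by rewrite j0 expr1 coefM big_ord1 coefD coefXM addr0 V0 W0 mulr1.
have -> : (l == m) = false by apply/negbTE; rewrite neq_ltn; lia.
(* Differentiating V W = 1 mod y^(m+1) loses one order, which the factor y restores. *)
have dVW : 'X^(m.+1) %| 'X * (V^`() * W) - - ('X * (V * W^`())).
  rewrite opprK -mulrDr -derivM -[V * W](subrK 1) derivD derivC addr0.
  have /dvdpP[r ->] := VW.
  rewrite derivM derivXn mulrDr; apply: dvdp_add.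
    by rewrite mulrA dvdp_mull.
  rewrite /= -mulr_natl (_ : _ * (r * _) = m.+1%:R * r * 'X^(m.+1)).
    by rewrite dvdp_mull.
  by rewrite exprS; ring.
(* Exactness of the form: y W' W^(j-1) is y (W^j)' / j, whose coefficient at y^j is that of W^j. *)
pose D := j%:R * (('X * (W^`() * W ^+ j.-1)))`_j.
have DE : D = j%:R * (W ^+ j)`_j.
  rewrite /D -[in X in _ * X = _](prednK j0) coefXM /= -[in RHS](prednK j0).
  rewrite mulr_natl [RHS]mulr_natl prednK//.
  have := coef_deriv (W ^+ j) j.-1; rewrite deriv_exp coefMn prednK// => <-.
suff -> : ((V + 'X * V^`()) * W ^+ j.+1)`_j = (W ^+ j)`_j - ('X * (W^`() * W ^+ j.-1))`_j.
  apply/eqP; rewrite mulr0n subr_eq0; apply/eqP/(@mulfI _ j%:R).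
    by rewrite pnatr_eq0 -lt0n.
  by rewrite -DE.
rewrite mulrDl coefD exprS mulrA (coef_modXnM _ VW jm) mul1r; congr (_ + _).
rewrite (_ : _ * (W * _) = 'X * (V^`() * W) * W ^+ j); last by ring.
rewrite (coef_modXnM _ dVW jm) mulNr coefN; congr (- _).
rewrite -[in LHS](prednK j0) exprS.
rewrite (_ : _ * (W * _) = (V * W) * ('X * (W^`() * W ^+ j.-1))); last by ring.
by rewrite (coef_modXnM _ VW) ?mul1r// prednK.
Qed.

(* Lagrange inversion: [z^m] h is the residue of h(z) dz / z^(m+1), computed
   in the coordinate y with z = rho y V(y); W is the inverse of V mod y^(m+1). *)
Lemma coef_change_variable rho V W h (m : nat) : V`_0 = 1 -> 'X^(m.+1) %| V * W - 1 ->
  ((h \Po (rho *: ('X * V))) * (V + 'X * V^`()) * W ^+ m.+1)`_m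
  = rho ^+ m * h`_m.
Proof.
move=> V0 VW; rewrite comp_polyE !mulr_suml coef_sum.
transitivity (\sum_(i < size h) h`_i * rho ^+ i * (i == m :> nat)%:R).
  apply: eq_bigr => i _; rewrite -(residue_monomial i V0 VW).
  by rewrite exprZn exprMn -!scalerAl !coefZ mulrA -!mulrA.
case: (ltnP m (size h)) => mh; last first.
  rewrite nth_default// mulr0 big1// => i _.
  by rewrite ltn_eqF ?mulr0// (leq_trans (ltn_ord i)).
rewrite (bigD1 (Ordinal mh))//= eqxx mulr1 big1 ?addr0 1?mulrC// => i im.
by rewrite (_ : (_ == _) = false) ?mulr0//; apply: negbTE.
Qed.

End Residue.

(** * Hankel determinants, linear recurrences and rational functions *)

Section Hankel.
Variable F : fieldType.
Implicit Types (g : nat -> F) (p q : {poly F}).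

Definition hankel g n : 'M[F]_n := \matrix_(i < n, j < n) g (i + j)%N.

(** The linear functional sending X^i to [g i]; the Hankel matrix is that of the bilinear form (p,
    q) -> [moment g (p * q)] in the monomial basis. *)
Definition moment g p : F := \sum_(i < size p) p`_i * g i.

Lemma momentE n g p : (size p <= n)%N -> moment g p = \sum_(i < n) p`_i * g i.
Proof.
move=> pn; rewrite /moment (big_ord_widen n (fun i => p`_i * g i))//.
rewrite big_mkcond; apply: eq_bigr => i _; case: ltnP => // h.
by rewrite nth_default// mul0r.
Qed.

Lemma momentD g p q : moment g (p + q) = moment g p + moment g q.
Proof.
rewrite !(@momentE (maxn (size p) (size q))) ?leq_maxl ?leq_maxr ?size_polyD//.
by rewrite -big_split; apply: eq_bigr => i _; rewrite coefD mulrDl.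
Qed.

Lemma moment0 g : moment g 0 = 0.
Proof. by rewrite /moment size_poly0 big_ord0. Qed.

Lemma momentZ g c p : moment g (c *: p) = c * moment g p.
Proof.
rewrite (@momentE (size p)) ?size_scale_leq// mulr_sumr.
by apply: eq_bigr => i _; rewrite coefZ mulrA.
Qed.

Lemma moment_sum g (I : Type) (s : seq I) (P : pred I) (G : I -> {poly F}) :
  moment g (\sum_(i <- s | P i) G i) = \sum_(i <- s | P i) moment g (G i).
Proof. exact: (big_morph _ (momentD g) (moment0 g)). Qed.

Lemma momentMXn g p n : moment g (p * 'X^n) = \sum_(i < size p) p`_i * g (i + n)%N.
Proof.
have sz : (size (p * 'X^n)%R <= n + size p)%N.
  by rewrite (leq_trans (size_polyMleq _ _))// size_polyXn; lia.
rewrite (momentE _ sz) big_split_ord /= big1 ?add0r => [|i _].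
  apply: eq_bigr => i _; rewrite coefMXn /= ltnNge leq_addr /= addKn.
  by rewrite addnC.
by rewrite coefMXn ltn_ord mul0r.
Qed.

Lemma momentM g p q :
  moment g (p * q) = \sum_(i < size q) q`_i * moment g (p * 'X^i).
Proof.
rewrite -[q in LHS]coefK poly_def mulr_sumr moment_sum; apply: eq_bigr => i _.
by rewrite -scalerAr momentZ.
Qed.

Lemma hankel_rVpoly g n (x : 'rV[F]_n) (b : 'I_n) :
  (x *m hankel g n) ord0 b = moment g (rVpoly x * 'X^b).
Proof.
rewrite mxE momentMXn.
rewrite (big_ord_widen n (fun i => (rVpoly x)`_i * g (i + b)%N)) ?size_poly//.
rewrite [RHS]big_mkcond; apply: eq_bigr => i _; rewrite mxE coef_rVpoly_ord.
case: ltnP => // h; rewrite -coef_rVpoly_ord nth_default ?mul0r//.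
Qed.

(** The coefficients of the [B i], in reverse order, form a lower triangular matrix A with unit
    diagonal, and the right-hand matrix is A H A^T with H the Hankel matrix. The reversal is why g
    is read backwards from i + j. *)
Lemma det_hankel_moments g n (B : nat -> {poly F}) :
  (forall i, (i < n)%N -> (B i)`_0 = 1) ->
  (forall i, (i < n)%N -> (size (B i) <= i.+1)%N) ->
  \det (hankel g n) =
  \det (\matrix_(i < n, j < n) moment (fun c => g (i + j - c)%N) (B i * B j)).
Proof.
move=> B0 sB.
pose A := \matrix_(i < n, a < n) (if (a <= i)%N then (B i)`_(i - a) else 0).
have detA : \det A = 1.
  rewrite det_trig; last first.
    by apply/is_trig_mxP => i j ij; rewrite mxE leqNgt ij.
  by rewrite big1// => i _; rewrite mxE leqnn subnn B0.
transitivity (\det (A *m hankel g n *m A^T)).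
  by rewrite !det_mulmx det_tr detA mul1r mulr1.
congr (\det _); apply/matrixP => i j; rewrite !mxE momentM.
have wide (h : nat -> F) l (ln : (l < n)%N) :
    \sum_(b < n) (if (b <= l)%N then (B l)`_(l - b) else 0) * h b
    = \sum_(b < size (B l)) (B l)`_b * h (l - b)%N.
  rewrite (big_ord_widen l.+1 (fun b => (B l)`_b * h (l - b)%N)) ?sB//.
  rewrite [RHS]big_mkcond /= [RHS](reindex_inj rev_ord_inj) /=.
  rewrite (big_ord_widen n (fun b => if (l.+1 - b.+1 < size (B l))%N then
    (B l)`_(l.+1 - b.+1) * h (l - (l.+1 - b.+1))%N else 0))//.
  rewrite [RHS]big_mkcond; apply: eq_bigr => b _; rewrite [(b < l.+1)%N]ltnS subSS.
  case: (leqP b l) => bl; last by rewrite mul0r.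
  rewrite subKn//; case: ltnP => // h'; by rewrite nth_default ?mul0r.
transitivity (\sum_(b < n) (if (b <= j)%N then (B j)`_(j - b) else 0) *
    \sum_(a < n) (if (a <= i)%N then (B i)`_(i - a) else 0) * g (a + b)%N).
  apply: eq_bigr => b _; rewrite !mxE mulrC; congr (_ * _).
  by apply: eq_bigr => a _; rewrite !mxE.
rewrite (wide (fun b => \sum_(a < n) (if (a <= i)%N then (B i)`_(i - a) else 0)
  * g (a + b)%N) j (ltn_ord j)).
apply: eq_bigr => b _; congr (_ * _).
rewrite (wide (fun a => g (a + (j - b))%N) i (ltn_ord i)) momentMXn.
apply: eq_bigr => a _; congr (_ * g _).
have := ltn_ord a; have := ltn_ord b; have := sB _ (ltn_ord i).
have := sB _ (ltn_ord j); lia.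
Qed.

(* If x is in the kernel of the Hankel form of order i+1, dividing x by q
   leaves no remainder since the form of order r is nondegenerate, and the
   leading term of the quotient isolates the moment of q X^i. *)
Lemma hankel_recurrence g r M : \det (hankel g r) != 0 ->
  (forall n, (r < n <= M)%N -> \det (hankel g n) = 0) ->
  exists q, [/\ q \is monic, size q = r.+1 &
    forall b, (b < M)%N -> moment g (q * 'X^b) = 0].
Proof.
move=> Hr HM; have Hu : hankel g r \in unitmx by rewrite unitmxE unitfE.
(* Coordinates chosen so that q is orthogonal to X^b for every b < r. *)
pose y : 'rV[F]_r := - (\row_b g (r + b)%N) *m invmx (hankel g r).
pose q := 'X^r + rVpoly y.
have sy : (size (rVpoly y) <= r)%N by exact: size_poly.
have sq : size q = r.+1 by rewrite /q size_polyDl size_polyXn.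
have mq : q \is monic.
  by rewrite monicE lead_coefE sq coefD coefXn eqxx nth_default ?addr0.
exists q; split => // b; elim/ltn_ind: b => b IH bM.
case: (ltnP b r) => br.
  rewrite mulrDl momentD -(hankel_rVpoly g y (Ordinal br)) /y mulmxKV//.
  rewrite !mxE -exprD (@momentE (r + b).+1) ?size_polyXn//.
  rewrite big_ord_recr /= coefXn eqxx mul1r big1 ?add0r ?subrr// => i _.
  by rewrite coefXn ltn_eqF ?mul0r.
have /det0P[x xn0 xH] : \det (hankel g b.+1) == 0 by rewrite HM//; lia.
have xm c : (c <= b)%N -> moment g (rVpoly x * 'X^c) = 0.
  by move=> cb; rewrite -(hankel_rVpoly g x (Ordinal (cb : (c < b.+1)%N))) xH mxE.
have q0 : q != 0 by rewrite monic_neq0.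
pose d := rVpoly x %/ q; pose e := rVpoly x %% q.
have xde : rVpoly x = q * d + e by rewrite mulrC -divp_eq.
have se : (size e <= r)%N by rewrite -ltnS -sq ltn_modp.
have sx : (size (rVpoly x) <= b.+1)%N by exact: size_poly.
have sd : (size d <= b.+1 - r)%N by rewrite size_divp// sq /= leq_sub2r.
have qd c : moment g (q * d * 'X^c) = \sum_(i < size d) d`_i * moment g (q * 'X^(i + c)).
  rewrite -[d in LHS]coefK poly_def mulr_sumr mulr_suml moment_sum.
  by apply: eq_bigr => i _; rewrite -scalerAr -scalerAl momentZ -mulrA exprD.
have e0 : e = 0.
  have -> : e = rVpoly (poly_rV e : 'rV_r) by rewrite poly_rV_K.
  suff -> : (poly_rV e : 'rV_r) = 0 by rewrite linear0.
  apply: (can_inj (mulmxK Hu)); rewrite mul0mx; apply/rowP => c.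
  rewrite hankel_rVpoly poly_rV_K// mxE.
  have := xm c; rewrite xde mulrDl momentD qd => xc.
  rewrite big1 ?add0r in xc; first by apply: xc; have := ltn_ord c; lia.
  move=> i _; rewrite IH ?mulr0//; first by have := ltn_ord c; have := ltn_ord i; lia.
  by have := ltn_ord c; have := ltn_ord i; lia.
have d0 : d != 0.
  apply: contra_neq xn0 => d0.
  by apply: (can_inj rVpolyK); rewrite xde d0 e0 mulr0 addr0 linear0.
have sd0 : (0 < size d)%N by rewrite lt0n size_poly_eq0.
have [n sdE] : exists n, size d = n.+1 by exists (size d).-1; rewrite prednK.
(* Against X^(b-n), with n the degree of d, only the leading term of d reaches q X^b; the others
   vanish by induction. *)
have := xm (b - n)%N; rewrite xde e0 addr0 qd sdE big_ord_recr /= => /(_ (leq_subr _ _)).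
rewrite big1 ?add0r => [|i _]; last first.
  rewrite IH ?mulr0//; first by have := ltn_ord i; lia.
  by have := ltn_ord i; lia.
rewrite subnKC; last by lia.
have -> : d`_n = lead_coef d by rewrite lead_coefE sdE.
by move/eqP; rewrite mulf_eq0 lead_coef_eq0 (negbTE d0) => /eqP.
Qed.

End Hankel.

(** Let v be the reversal of q. The recurrence kills the coefficients r to M - 1 of v g, so v g
    agrees modulo X^M with a polynomial u of degree below r. As v(0) = 1, the gcd of u and v is
    prime to X and can be cancelled modulo X^M. *)
Lemma recurrence_quot_series (g : nat -> rat) (q : {poly rat}) r M :
  q \is monic -> size q = r.+1 ->
  (forall b, (b < M)%N -> moment g (q * 'X^b) = 0) ->
  exists u v : {poly rat},
    [/\ (size u <= r.+1)%N, (size v <= r.+1)%N, coprimep u v, v.[0] != 0 &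
     forall k, (k < M)%N -> g k = quot_series u v k].
Proof.
move=> mq sq qM.
pose v := \poly_(i < r.+1) q`_(r - i).
pose G := \poly_(i < M) g i.
pose u := take_poly r (v * G).
have v0 : v.[0] = 1.
  rewrite horner_coef0 coef_poly /= subn0.
  by have /monicP := mq; rewrite lead_coefE sq.
have vn0 : v != 0.
  by apply/eqP => v00; move: v0; rewrite v00 horner0 => /eqP; rewrite eq_sym oner_eq0.
have dvd1 : 'X^M %| v * G - u.
  rewrite dvdXn_coef; apply/forallP => k; rewrite coefB coef_take_poly.
  case: ltnP => [_|rk]; first by rewrite subrr.
  rewrite subr0 coefM; apply/eqP.
  have kM := ltn_ord k.
  have krM : (k - r < M)%N by lia.
  rewrite -[RHS](qM (k - r)%N krM) momentMXn sq.
  rewrite -(big_mkord xpredT (fun i => v`_i * G`_(k - i))).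
  rewrite (@big_cat_nat _ _ _ r.+1)//= [X in _ + X]big_nat_cond.
  rewrite [X in _ + X]big1 ?addr0; last first.
    by move=> i /andP[/andP[ri _] _]; rewrite coef_poly ltnNge ri mul0r.
  rewrite big_nat_rev /= add0n big_mkord; apply: eq_bigr => i _.
  have ir := ltn_ord i.
  rewrite !coef_poly (_ : (r.+1 - i.+1 < r.+1)%N); last by lia.
  rewrite (_ : (k - (r.+1 - i.+1) < M)%N); last by lia.
  by congr (q`_ _ * g _); lia.
have dv : gcdp u v %| v by rewrite dvdp_gcdr.
have du : gcdp u v %| u by rewrite dvdp_gcdl.
pose d := gcdp u v; pose u1 := u %/ d; pose v1 := v %/ d.
have uE : u = d * u1 by rewrite mulrC divpK.
have vE : v = d * v1 by rewrite mulrC divpK.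
have dn0 : d != 0 by rewrite gcdp_eq0 negb_and vn0 orbT.
have hd0 : d.[0] != 0.
  by apply/eqP => d0; move: v0; rewrite vE hornerM d0 mul0r => /eqP; rewrite eq_sym oner_eq0.
have hv1 : v1.[0] != 0.
  by apply/eqP => d0; move: v0; rewrite vE hornerM d0 mulr0 => /eqP; rewrite eq_sym oner_eq0.
have dvd2 : 'X^M %| v1 * G - u1.
  rewrite -(@Gauss_dvdpr _ _ d); first by rewrite mulrBr mulrA -vE -uE.
  rewrite coprimep_expl// coprimep_sym -['X]subr0 -polyC0 coprimep_XsubC.
  by rewrite /root.
have su : (size u <= r.+1)%N by rewrite ltnW// ltnS; exact: size_take_poly.
have sv : (size v <= r.+1)%N by exact: size_poly.
exists u1, v1; split => //.
- by apply: leq_trans su; rewrite leq_divp.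
- by apply: leq_trans sv; rewrite leq_divp.
- by rewrite coprimep_div_gcd// vn0 orbT.
move=> k; elim/ltn_ind: k => k IH kM.
have kE : \sum_(i < k.+1) v1`_i * g (k - i)%N = u1`_k.
  have := coef_modXnM 1 dvd2 kM; rewrite !mulr1 coefM => <-.
  apply: eq_bigr => i _; rewrite coef_poly (_ : (k - i < M)%N)//.
  by rewrite (leq_ltn_trans (leq_subr _ _)).
have := quot_seriesP u1 hv1 k; rewrite -kE !big_ord_recl /= subn0.
rewrite [X in _ + X = _](_ : _ = \sum_(i < k) v1`_(bump 0 i) * g (k - bump 0 i)%N); last first.
  by apply: eq_bigr => i _; rewrite IH//; have := ltn_ord i; rewrite /bump /=; lia.
by move/addIr/mulfI => -> //; rewrite -horner_coef0.
Qed.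

(** * Integer-valued polynomials *)

Definition binomial_poly k : {poly rat} :=
  k`!%:R^-1 *: \prod_(i < k) ('X - i%:R%:P).

Lemma size_binomial_poly k : (size (binomial_poly k) <= k.+1)%N.
Proof.
apply: leq_trans (size_scale_leq _ _) _.
rewrite -(big_mkord xpredT (fun i => 'X - i%:R%:P)) size_prod_XsubC.
by rewrite size_iota subn0.
Qed.

Lemma natr_fact_neq0 k : (k`!%:R : rat) != 0.
Proof. by rewrite pnatr_eq0 -lt0n fact_gt0. Qed.

Lemma prod_subr_ffact j k : \prod_(i < k) (j%:R - i%:R) = (j ^_ k)%:R :> rat.
Proof.
elim: k => [|k IH]; first by rewrite big_ord0 ffactn0.
rewrite big_ord_recr /= IH ffactnSr natrM; case: (leqP k j) => kj.
  by rewrite natrB.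
by rewrite ffact_small ?mul0r.
Qed.

Lemma prod_addr_ffact n k :
  \prod_(i < k) (- n.+1%:R - i%:R) = (-1) ^+ k * ((n + k) ^_ k)%:R :> rat.
Proof.
elim: k => [|k IH]; first by rewrite big_ord0 ffactn0 expr0 mulr1.
rewrite big_ord_recr /= IH addnS ffactSS natrM exprS -addSn natrD.
by ring.
Qed.

Lemma horner_binomial_poly k j : (binomial_poly k).[j%:R] = 'C(j, k)%:R.
Proof.
rewrite hornerZ horner_prod.
under eq_bigr do rewrite hornerXsubC.
by rewrite prod_subr_ffact -bin_ffact natrM mulrC mulfK// natr_fact_neq0.
Qed.

Lemma binomial_poly_integer_valued k : integer_valued (binomial_poly k).
Proof.
case=> n; first by rewrite -pmulrn horner_binomial_poly natr_int.
(* At negative integers, C(-n-1, k) = (-1)^k C(n+k, k). *)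
rewrite NegzE mulrNz -pmulrn hornerZ horner_prod.
under eq_bigr do rewrite hornerXsubC.
rewrite prod_addr_ffact -bin_ffact natrM mulrCA [_^-1 * _]mulrC mulfK ?natr_fact_neq0//.
by rewrite rpredM ?natr_int// rpredX// rpredN.
Qed.

(** Pigeonhole on the vectors with entries in [0, X], where X = (n+1) A: their images lie in
    [0, X^2]^e, and (X^2 + 1)^e <= (X + 1)^(2e) < (X + 1)^(n+1). The difference of two vectors with
    the same image is a solution. *)
Lemma siegel e n A (M : 'I_e -> 'I_n.+1 -> nat) :
  (0 < A)%N -> (e.*2 <= n)%N -> (forall i j, M i j <= A)%N ->
  exists c : 'I_n.+1 -> int, [/\ exists j, c j != 0,
    forall j, (`|c j| <= n.+1 * A)%N &
    forall i, \sum_j c j * (M i j)%:Z = 0].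
Proof.
move=> A0 en MA; set X := (n.+1 * A)%N.
have X0 : (0 < X)%N by rewrite muln_gt0.
pose f (x : {ffun 'I_n.+1 -> 'I_X.+1}) : {ffun 'I_e -> 'I_(X * X).+1} :=
  [ffun i => inord (\sum_j M i j * x j)%N].
have sumle x i : (\sum_j M i j * (x : {ffun 'I_n.+1 -> 'I_X.+1}) j <= X * X)%N.
  apply: (@leq_trans (\sum_(j < n.+1) (A * X))); last first.
    by rewrite sum_nat_const card_ord mulnA.
  by apply: leq_sum => j _; rewrite leq_mul// -ltnS.
have : ~~ injectiveb f.
  apply/negP => /injectiveP /leq_card; rewrite !card_ffun !card_ord leqNgt.
  apply/negP; rewrite negbK; apply: (@leq_ltn_trans (X.+1 ^ n)); last first.
    by rewrite ltn_exp2l.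
  apply: (@leq_trans (X.+1 ^ e.*2)); last by rewrite leq_exp2l.
  have XX : ((X * X).+1 <= X.+1 ^ 2)%N by rewrite -mulnn; nia.
  rewrite -mul2n expnM; elim: (e) => [//|e' IH].
  by rewrite !(expnS _ e') leq_mul.
case/injectivePn => x [y xy fxy].
exists (fun j => (x j)%:Z - (y j)%:Z); split.
- apply/existsP; apply: contra_neqT xy; rewrite negb_exists => /forallP h.
  apply/ffunP => j; apply/val_inj/eqP.
  by have := h j; rewrite negbK subr_eq0 eqz_nat.
- by move=> j; have := ltn_ord (x j); have := ltn_ord (y j); lia.
move=> i; have := congr1 (fun u : {ffun 'I_e -> 'I_(X * X).+1} => val (u i)) fxy.
rewrite /= !ffunE !inordK ?ltnS ?sumle// => h.
under eq_bigr do rewrite mulrBl -!PoszM.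
rewrite sumrB; apply/eqP; rewrite subr_eq0.
rewrite -!(big_morph Posz PoszD (erefl 0)).
rewrite eqz_nat; apply/eqP; move: h; under eq_bigr do rewrite mulnC.
by move=> ->; apply: eq_bigr => j _; rewrite mulnC.
Qed.

(** In binomial coordinates, vanishing at the elements of S up to N is a linear system with entries
    C(j, k), to which [siegel] applies. *)
Lemma vanishing_integer_valued (S : set nat) (N n A : nat) :
  ((\sum_(0 <= i < N.+1 | i \in S) 1).*2 <= n)%N -> (0 < A)%N ->
  (forall j k, (j <= N)%N -> (k <= n)%N -> ('C(j, k) <= A)%N) ->
  exists (c : nat -> int) (P : {poly rat}),
    [/\ forall k, (`|c k| <= n.+1 * A)%N,
        P != 0, integer_valued P, (size P <= n.+1)%N &
        (forall j, P.[j%:R] = \sum_(k < n.+1) (c k)%:~R * 'C(j, k)%:R) /\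
        forall j, (j <= N)%N -> j \in S -> P.[j%:R] = 0].
Proof.
move=> Sn A0 CA; pose s := [seq i <- iota 0 N.+1 | i \in S].
have ss : size s = (\sum_(0 <= i < N.+1 | i \in S) 1)%N.
  by rewrite size_filter -sum1_count /index_iota subn0.
have sN i : (i < size s)%N -> (nth 0%N s i <= N)%N.
  by move=> /(mem_nth 0%N); rewrite mem_filter mem_iota add0n => /andP[_ /andP[_]].
rewrite -ss in Sn.
have [|c [[j0 cj0] cA cM]] := @siegel (size s) n A (fun i k => 'C(nth 0%N s i, k)) A0 Sn.
  by move=> i j; rewrite CA ?sN// -ltnS.
(* Beyond n, [inord] falls back on the index 0, so the bound on the coordinates holds for all k. *)
pose d k := c (inord k).
pose P := \sum_(k < n.+1) (d k)%:~R *: binomial_poly k.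
have PE j : P.[j%:R] = \sum_(k < n.+1) (d k)%:~R * 'C(j, k)%:R.
  rewrite horner_sum; apply: eq_bigr => k _.
  by rewrite hornerZ horner_binomial_poly.
exists d, P; split => //.
- by move=> k; exact: cA.
- have ex : exists k, (k <= n)%N && (d k != 0).
    by exists j0; rewrite /d inord_val cj0 -ltnS ltn_ord.
  (* At the least index k with a nonzero coordinate, P(k) is that coordinate, since the later
     binomials vanish at k. *)
  case: (ex_minnP ex) => k /andP[kn dk] kmin.
  apply/eqP => P0; have := PE k; rewrite P0 horner0 => /esym/eqP.
  rewrite (bigD1 (Ordinal (kn : (k < n.+1)%N)))//= binn mulr1 big1 ?addr0.
    by rewrite intr_eq0 (negbTE dk).
  move=> i ik; case: (ltnP k i) => ki; first by rewrite bin_small ?mulr0.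
  have : ~~ ((i <= n)%N && (d i != 0)).
    apply/negP => /kmin; apply/negP; rewrite -ltnNge ltn_neqAle ki andbT.
    by apply: contra ik => /eqP h; apply/eqP/val_inj.
  by rewrite -ltnS ltn_ord /= negbK => /eqP ->; rewrite mul0r.
- move=> m; rewrite horner_sum rpred_sum// => k _.
  by rewrite hornerZ rpredM ?intr_int//; exact: binomial_poly_integer_valued.
- apply: leq_trans (size_sum _ _ _) _; apply/bigmax_leqP => k _.
  apply: leq_trans (size_scale_leq _ _) _.
  by apply: leq_trans (size_binomial_poly _) _.
split => // j jN jS.
have js : j \in s by rewrite mem_filter jS mem_iota.
have jis : (index j s < size s)%N by rewrite index_mem.
rewrite PE; have := congr1 (fun z : int => z%:~R : rat) (cM (Ordinal jis)).
rewrite /= nth_index// mulr0z rmorph_sum /= => h; rewrite -[RHS]h.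
by apply: eq_bigr => k _; rewrite /d inord_val rmorphM.
Qed.

Lemma den_mul_int (q : rat) (d : nat) : (den q %| d)%N -> d%:R * q \is a Num.int.
Proof.
move=> /dvdnP[m ->]; rewrite natrM -mulrA rpredM ?natr_int//.
by rewrite /den; case: ex_minnP => e /andP[].
Qed.

Lemma det_hankel_int0 (g : nat -> rat) d n : (0 < d)%N ->
  (forall i, (i <= n.*2)%N -> d%:R * g i \is a Num.int) ->
  d%:R ^+ n * `|\det (hankel g n)| < 1 -> \det (hankel g n) = 0.
Proof.
move=> d0 gint lt1; have : d%:R ^+ n * \det (hankel g n) \is a Num.int.
  rewrite -detZ rpred_sum// => s _; rewrite rpredM ?rpredX ?rpredN//.
  apply: rpred_prod => i _; rewrite !mxE gint//.
  by have := ltn_ord i; have := ltn_ord (s i); lia.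
have [->//|h0] := eqVneq (\det (hankel g n)) 0.
move=> /norm_intr_ge1; rewrite mulf_neq0 ?expf_neq0 ?pnatr_eq0 -?lt0n//.
by move=> /(_ isT); rewrite normrM normrX normr_nat leNgt lt1.
Qed.

(** * Upper bounds for Hankel determinants *)

Section HankelBound.
Variable R : realType.
Implicit Types (g : nat -> R[i]) (Q : {poly R[i]}).

Lemma fact_le_expn n : (n`! <= n ^ n)%N.
Proof.
rewrite fact_prod big_add1 /= big_mkord -[X in (_ <= _ ^ X)%N]card_ord.
by rewrite -prod_nat_const leq_prod.
Qed.

(** Each term of the Leibniz expansion meets every row and every column once, so all n! terms have
    the same bound. *)
Lemma normc_det_le n (A : 'M[R[i]]_n) (b c : 'I_n -> R) :
  (forall i j, normc (A i j) <= b i * c j) ->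
  normc (\det A) <= n`!%:R * (\prod_i b i * \prod_i c i).
Proof.
move=> Ab; rewrite /determinant; apply: le_trans (ler_normc_sum _ _ _) _.
apply: (@le_trans _ _ (\sum_(s : 'S_n) (\prod_i b i * \prod_i c i))); last first.
  by rewrite sumr_const mulr_natl (_ : #|_| = n`!)// -card_Sn; apply: eq_card.
apply: ler_sum => s _; rewrite normcM normcX normcN normc_1 expr1n mul1r.
rewrite normc_prod [X in _ <= _ * X](reindex_inj (@perm_inj _ s)) -big_split.
by apply: ler_prod => i _; rewrite normc_ge0 Ab.
Qed.

(* Row i uses the polynomial Q^s with i = k s + t and t < k; among the indices
   i and n - 1 - i one is at least n / 2. *)
Lemma det_hankel_bound g Q k n (K theta : R) : (0 < k)%N ->
  Q`_0 = 1 -> (size Q <= k.+1)%N -> 0 <= K -> 0 <= theta <= 1 ->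
  (forall s t, (t < k.*2)%N -> (k * s + t <= n.*2)%N ->
    normc (moment (fun c => g (k * s + t - c)%N) (Q ^+ s)) <= K * theta ^+ s) ->
  normc (\det (hankel g n)) <= (n%:R * K * theta ^+ (n %/ k.*2)) ^+ n.
Proof.
move=> k0 Q0 sQ K0 /andP[t0 t1] gQ.
have sQs s : (size (Q ^+ s) <= (k * s).+1)%N.
  apply: leq_trans (size_poly_exp_leq _ _) _; rewrite ltnS leq_mul2r.
  by rewrite -ltnS (leq_trans (leqSpred _)) ?orbT// ; lia.
have Qs0 s : (Q ^+ s)`_0 = 1 by rewrite -horner_coef0 horner_exp horner_coef0 Q0 expr1n.
(* Q^(i / k) has degree at most i, as row i requires. *)
rewrite (@det_hankel_moments _ g n (fun i => Q ^+ (i %/ k))); first last.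
- by move=> i _; apply: leq_trans (sQs _) _; rewrite ltnS mulnC leq_trunc_div.
- by move=> i _.
apply: le_trans (@normc_det_le _ _ (fun i => K * theta ^+ (i %/ k))
  (fun j => theta ^+ (j %/ k)) _) _.
  move=> i j; rewrite mxE -exprD -mulrA -exprD.
  have ijE : (i + j = k * (i %/ k + j %/ k) + (i %% k + j %% k))%N.
    by rewrite {1}(divn_eq i k) {1}(divn_eq j k); lia.
  rewrite [X in moment X _](_ : _ =
    (fun c => g (k * (i %/ k + j %/ k) + (i %% k + j %% k) - c)%N)); last first.
    by apply/funext => c; rewrite -ijE.
  apply: gQ; first by have := ltn_pmod i k0; have := ltn_pmod j k0; lia.
  by rewrite -ijE; have := ltn_ord i; have := ltn_ord j; lia.
rewrite -mulrA exprMn ler_pM ?ler0n//.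
- by rewrite mulr_ge0 ?prodr_ge0// => i _; rewrite ?mulr_ge0 ?exprn_ge0.
- by rewrite -natrX ler_nat fact_le_expn.
rewrite [X in _ * X](reindex_inj rev_ord_inj) -big_split /=.
rewrite -[X in _ <= _ ^+ X]card_ord -prodr_const; apply: ler_prod => i _.
rewrite !mulr_ge0 ?exprn_ge0//= -mulrA -exprD ler_wpM2l// ler_wiXn2l//.
rewrite -mul2n divnMA divn2.
case: (leqP n./2 i) => h.
  by rewrite (leq_trans (leq_div2r k h))// leq_addr.
rewrite (leq_trans _ (leq_addl _ _))// leq_div2r//.
by have := ltn_ord i; lia.
Qed.

End HankelBound.

(** * Power series continued across a boundary point *)

Section PowerSeries.
Variable R : realType.
Implicit Types (c : nat -> R[i]) (z w : R[i]) (r rho M : R).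

(** Power series are handled through their truncations, so that composition, derivatives and [wnorm]
    stay within polynomials. *)
Definition trunc c L : {poly R[i]} := \poly_(k < L) c k.

Lemma power_series_trunc c z L :
  @power_series (complexes R) c z L = (trunc c L).[z].
Proof. by rewrite /power_series seriesEord /trunc horner_poly. Qed.

Lemma exp_small (q eta : R) : 0 <= q < 1 -> 0 < eta ->
  exists L0, forall L, (L0 <= L)%N -> q ^+ L <= eta.
Proof.
move=> /andP[q0 q1] eta0; have q1' : `|q| < 1 by rewrite ger0_norm.
have /cvgrPdist_lt/(_ eta eta0)[L0 _ h] := cvg_expr q1'.
exists L0 => L LL; have := h L LL; rewrite sub0r normrN.
by move/ltW; apply: le_trans; exact: ler_norm.
Qed.

Lemma cvg_coef_bound c z : cvgn (@power_series (complexes R) c z) ->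
  exists M, forall k, normc (c k) * normc z ^+ k <= M.
Proof.
move=> /cvg_series_cvg_0 /cvgr0Pnorm_lt /(_ 1 ltr01)[N _ h].
exists (1 + \sum_(k < N) normc (c k) * normc z ^+ k) => k.
have pos (i : nat) : 0 <= normc (c i) * normc z ^+ i.
  by rewrite mulr_ge0 ?normc_ge0// exprn_ge0// normc_ge0.
case: (ltnP k N) => kN.
  rewrite (bigD1 (Ordinal kN))//= addrCA lerDl addr_ge0// sumr_ge0//.
apply: ler_wpDr; first by rewrite sumr_ge0.
have := h k kN; rewrite -normcX -normcM => /ltW hk.
rewrite normc_le; exact: hk.
Qed.

Lemma geom_sum_le (q : R) n : 0 <= q < 1 -> \sum_(i < n) q ^+ i <= (1 - q)^-1.
Proof.
move=> /andP[q0 q1]; have q1' : 0 < 1 - q by rewrite subr_gt0.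
rewrite -(ler_pM2l q1') mulfV ?gt_eqF//.
have := subrXX 1 q n; rewrite expr1n => E.
rewrite (_ : \sum_(i < n) q ^+ i = \sum_(i < n) 1 ^+ (n.-1 - i) * q ^+ i).
  by rewrite -E lerBlDr lerDl exprn_ge0.
by apply: eq_bigr => i _; rewrite expr1n mul1r.
Qed.

Section Geometric.
Variables (c : nat -> R[i]) (rho M r : R).
Hypothesis (cM : forall k, normc (c k) * rho ^+ k <= M).
Hypothesis (r0 : 0 <= r) (rrho : r < rho).

Let rho0 : 0 < rho. Proof. exact: le_lt_trans rrho. Qed.

Let q01 : 0 <= r / rho < 1.
Proof. by rewrite divr_ge0 ?(ltW rho0)//= ltr_pdivrMr// mul1r. Qed.

Let M0 : 0 <= M.
Proof. by apply: le_trans (cM 0); rewrite expr0 mulr1 normc_ge0. Qed.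

Let term k : normc (c k) * r ^+ k <= M * (r / rho) ^+ k.
Proof.
rewrite expr_div_n mulrA ler_pdivlMr ?exprn_gt0// mulrAC.
by rewrite ler_wpM2r// exprn_ge0.
Qed.

Lemma wnorm_trunc L : wnorm r (trunc c L) <= M * (1 - r / rho)^-1.
Proof.
apply: (@le_trans _ _ (\sum_(k < L) M * (r / rho) ^+ k)).
  rewrite (@wnormE _ L) ?size_poly//; apply: ler_sum => k _.
  by rewrite coef_poly ltn_ord term.
by rewrite -mulr_sumr ler_wpM2l// geom_sum_le.
Qed.

Lemma trunc_tail L L' z : (L <= L')%N -> normc z <= r ->
  normc ((trunc c L').[z] - (trunc c L).[z])
  <= M * (1 - r / rho)^-1 * (r / rho) ^+ L.
Proof.
move=> LL zr; rewrite !horner_poly -!(big_mkord xpredT (fun k => c k * z ^+ k)).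
rewrite (@big_cat_nat _ _ _ L 0 L')//= addrAC subrr add0r.
rewrite -{1}[L]add0n big_addn big_mkord.
apply: le_trans (ler_normc_sum _ _ _) _.
apply: (@le_trans _ _ (\sum_(k < L' - L) M * (r / rho) ^+ L * (r / rho) ^+ k)).
  apply: ler_sum => k _; rewrite -mulrA -exprD addnC.
  apply: le_trans (term _); rewrite normcM normcX ler_wpM2l ?normc_ge0//.
  by rewrite lerXn2r// nnegrE ?normc_ge0.
rewrite -mulr_sumr mulrAC ler_wpM2r ?exprn_ge0 ?(andP q01).1//.
by rewrite ler_wpM2l// geom_sum_le.
Qed.

End Geometric.

Lemma taylor_coef_bound (p : {poly R[i]}) z (rho r : R) j : 0 <= r ->
  normc z + r <= rho ->
  normc (p \Po ('X + z%:P))`_j * r ^+ j <= wnorm rho p.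
Proof.
move=> r0 zr; apply: le_trans (normc_coef_le _ _ r0) _.
apply: le_trans (wnorm_comp _ _ r0) _; apply: le_wnorm.
  by rewrite wnorm_ge0.
by apply: le_trans (wnormD _ _ r0) _; rewrite wnormX wnormC addrC.
Qed.

(* c is the expansion at w of the continuation of the power series with
   coefficients a; no reference to the continuation itself is needed. *)
Definition continues_at (a : nat -> R[i]) w :=
  exists (c : nat -> R[i]) r, [/\ 0 < r,
    exists M, forall k, normc (c k) * r ^+ k <= M &
    forall z, normc z < 1 -> normc (z - w) <= r -> forall eta, 0 < eta ->
      exists L0, forall L, (L0 <= L)%N ->
        normc ((trunc a L).[z] - (trunc c L).[z - w]) <= eta].

Definition disk_bounded (a : nat -> R[i]) :=
  forall rho, 0 < rho < 1 -> exists M, forall k, normc (a k) * rho ^+ k <= M.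

(* Near w the Taylor coefficients of the truncations of a are compared with
   those of the expansion at w through the Cauchy estimates. *)
Lemma taylor_bound (a : nat -> R[i]) w : disk_bounded a -> continues_at a w ->
  exists2 d : R, 0 < d & forall r rho sigma : R,
    0 < r <= d -> rho < 1 -> sigma < 1 ->
    exists2 M, 0 <= M & forall j, exists L0, forall L, (L0 <= L)%N ->
      forall z, normc z <= rho ->
      normc (z - w) <= d \/ normc z + r <= sigma ->
      normc (trunc a L \Po ('X + z%:P))`_j * r ^+ j <= M.
Proof.
move=> ab [c [r0 [r00 [M cM] near_w]]].
(* A disk of radius d about a point within d of w stays within 2 d of w, where the expansion c still
   converges geometrically. *)
have [d d4] : exists d : R, d * 4 = r0 by exists (r0 / 4); lra.
have d0 : 0 < d by lra.
exists d => // r rho sigma /andP[r_gt0 rd] rho1 sigma1.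
have [rho' [rho'01 rhorho']] : exists x : R, 0 < x < 1 /\ rho < x.
  exists ((1 + Num.max 0 rho) / 2); by case: (leP 0 rho) => h; split; lra.
have [M1 aM1] : exists M, forall k, normc (a k) * ((1 + rho') / 2) ^+ k <= M.
  by apply: ab; lra.
have [sg [sg01 sgs]] : exists x : R, 0 <= x < 1 /\ sigma <= x.
  by exists (Num.max 0 sigma); case: (leP 0 sigma) => h; split; lra.
have [M2 aM2] : exists M, forall k, normc (a k) * ((1 + sg) / 2) ^+ k <= M.
  by apply: ab; lra.
have [K2 K2P] : exists K, forall L, wnorm sg (trunc a L) <= K.
  exists (M2 * (1 - sg / ((1 + sg) / 2))^-1) => L.
  by apply: wnorm_trunc => //; lra.
have [K1 K1P] : exists K, forall L, wnorm (2 * d) (trunc c L) <= K.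
  by exists (M * (1 - (2 * d) / r0)^-1) => L; apply: wnorm_trunc => //; lra.
have K20 : 0 <= K2 by apply: le_trans (K2P 0%N); rewrite wnorm_ge0//; lra.
have K10 : 0 <= K1 by apply: le_trans (K1P 0%N); rewrite wnorm_ge0//; lra.
exists (1 + K1 + K2); first by rewrite !addr_ge0.
move=> j.
(* Circles of radius kap about the points z near w stay inside the unit disk and within 2 d of w. *)
have [kap [kap0 kap1 kap2]] : exists x : R, [/\ 0 < x, x <= rho' - rho & x <= d].
  by exists (Num.min (rho' - rho) d); case: (leP (rho' - rho) d) => h; split; lra.
(* An error eta on those circles gives, by the Cauchy estimate, an error of at most 1 on the j-th
   coefficient at radius d. As eta depends on j, so does [L0]. *)
have [eta [eta0 etaE]] : exists eta : R, 0 < eta /\ eta * d ^+ j = kap ^+ j.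
  exists (kap ^+ j / d ^+ j); rewrite divr_gt0 ?exprn_gt0// divfK//.
  by rewrite expf_neq0// gt_eqF.
have [q1 [T1 [q1E T1P]]] : exists q T : R, 0 <= q < 1 /\ forall L L' z,
    (L <= L')%N -> normc z <= rho' ->
    normc ((trunc a L').[z] - (trunc a L).[z]) <= T * q ^+ L.
  exists (rho' / ((1 + rho') / 2)), (M1 * (1 - rho' / ((1 + rho') / 2))^-1).
  split; first by rewrite divr_ge0/= ?ltr_pdivrMr; lra.
  by move=> L L' z LL zr; apply: trunc_tail => //; lra.
have [q2 [T2 [q2E T2P]]] : exists q T : R, 0 <= q < 1 /\ forall L L' z,
    (L <= L')%N -> normc z <= 2 * d ->
    normc ((trunc c L').[z] - (trunc c L).[z]) <= T * q ^+ L.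
  exists ((2 * d) / r0), (M * (1 - (2 * d) / r0)^-1).
  split; first by rewrite divr_ge0/= ?ltr_pdivrMr; lra.
  by move=> L L' z LL zr; apply: trunc_tail => //; lra.
have T10 : 0 <= T1.
  by have := T1P 0%N 0%N 0 (leqnn _); rewrite normc_0 subrr normc_0 expr0 mulr1; apply; lra.
have T20 : 0 <= T2.
  by have := T2P 0%N 0%N 0 (leqnn _); rewrite normc_0 subrr normc_0 expr0 mulr1; apply; lra.
have t1 : 0 < 3 * T1 + 3 by lra.
have t2 : 0 < 3 * T2 + 3 by lra.
have [L1 L1P] := exp_small q1E (divr_gt0 eta0 t1).
have [L2 L2P] := exp_small q2E (divr_gt0 eta0 t2).
(* [near_w] is only pointwise in z; the geometric tails of both truncations make the comparison
   uniform. *)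
have unif L z : (maxn L1 L2 <= L)%N -> normc z <= rho' -> normc (z - w) <= 2 * d ->
    normc ((trunc a L).[z] - (trunc c L).[z - w]) <= eta.
  rewrite geq_max => /andP[LL1 LL2] zr zw.
  have [|||L3 L3P] := @near_w z _ _ (eta / 3).
  - lra.
  - by lra.
  - lra.
  pose L' := maxn L L3.
  have h1 := T1P L L' z (leq_maxl _ _) zr.
  have h2 := T2P L L' _ (leq_maxl _ _) zw.
  have h3 := L3P L' (leq_maxr _ _).
  have e1 : T1 * q1 ^+ L <= eta / 3.
    apply: (@le_trans _ _ (T1 * (eta / (3 * T1 + 3)))).
      by rewrite ler_wpM2l// L1P.
    by rewrite mulrA ler_pdivrMr//; nra.
  have e2 : T2 * q2 ^+ L <= eta / 3.
    apply: (@le_trans _ _ (T2 * (eta / (3 * T2 + 3)))).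
      by rewrite ler_wpM2l// L2P.
    by rewrite mulrA ler_pdivrMr//; nra.
  set A := (trunc a L).[z] in h1 *; set A' := (trunc a L').[z] in h1 h3.
  set C := (trunc c L).[z - w] in h2 *; set C' := (trunc c L').[z - w] in h2 h3.
  rewrite (_ : A - C = (A' - C') - (A' - A) + (C' - C)); last by ring.
  have := le_normcD (A' - C' - (A' - A)) (C' - C).
  have := le_normcD (A' - C') (- (A' - A)); rewrite normcN.
  lra.
exists (maxn L1 L2) => L LL z zrho [zw|zs]; last first.
  apply: (@le_trans _ _ K2); last by lra.
  by apply: le_trans (K2P L); apply: taylor_coef_bound; lra.
apply: (@le_trans _ _ (1 + K1)); last by lra.
apply: (@le_trans _ _ (normc (trunc a L \Po ('X + z%:P))`_j * d ^+ j)).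
  by rewrite ler_wpM2l ?normc_ge0// lerXn2r// nnegrE; lra.
pose E := trunc a L - (trunc c L \Po ('X - w%:P)).
have -> : trunc a L = E + (trunc c L \Po ('X - w%:P)) by rewrite subrK.
rewrite comp_polyD coefD -comp_polyA.
rewrite (_ : ('X - w%:P) \Po ('X + z%:P) = 'X + (z - w)%:P); last first.
  by rewrite comp_polyB comp_polyX comp_polyC polyCB addrA.
have h1 : normc (E \Po ('X + z%:P))`_j * kap ^+ j <= eta.
  apply: cauchy_estimate => [|y yk]; first exact: ltW.
  rewrite horner_comp /E !hornerE horner_comp !hornerE.
  apply: unif => //.
    by apply: le_trans (le_normcD _ _) _; rewrite yk; lra.
  by rewrite -addrA; apply: le_trans (le_normcD _ _) _; rewrite yk; lra.
have h2 : normc (trunc c L \Po ('X + (z - w)%:P))`_j * d ^+ j <= K1.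
  by apply: le_trans (K1P L); apply: taylor_coef_bound; lra.
have h3 : normc (E \Po ('X + z%:P))`_j * d ^+ j <= 1.
  have kj : 0 < kap ^+ j by rewrite exprn_gt0.
  have dj : 0 < d ^+ j by rewrite exprn_gt0.
  by rewrite -(ler_pM2r kj) mul1r mulrAC -[X in _ <= X]etaE ler_pM2r.
have hd : 0 <= d ^+ j by rewrite exprn_ge0// ltW.
have := ler_wpM2r hd (le_normcD (E \Po ('X + z%:P))`_j (trunc c L \Po ('X + (z - w)%:P))`_j).
by rewrite mulrDl; lra.
Qed.

Lemma lt_complexes (z : complexes R) r :
  normc z < r -> `|z| < (r%:C%C : complexes R).
Proof. by rewrite normc_lt. Qed.

Lemma cvg_disk_bounded (a : nat -> R[i]) :
  (forall z : complexes R, `|z| < 1 -> cvgn (power_series a z)) -> disk_bounded a.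
Proof.
move=> acvg rho /andP[rho0 rho1].
have [|M aM] := @cvg_coef_bound a (rho%:C%C).
  by apply: acvg; apply: lt_complexes; rewrite normc_real gtr0_norm.
by exists M => k; have := aM k; rewrite normc_real gtr0_norm.
Qed.

Lemma continuable_continues (a : nat -> R[i]) w :
  (forall z : complexes R, `|z| < 1 -> cvgn (power_series a z)) ->
  continuable_at (sum_fun (a : nat -> complexes R)) w -> continues_at a w.
Proof.
move=> acvg [U [g [oU Uw ga gf]]].
have [c [r [r0 cr]]] := ga w Uw.
have /nbhs_ballP[e /= e0 eU] := open_nbhs_nbhs (conj oU Uw).
(* In the order of [R[i]] a positive element is real, so both radii come from R. *)
have [r' r'E] : exists r' : R, r = r'%:C%C.
  exists (complex.Re r); move: r0; rewrite ltcE => /andP[/eqP h _].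
  by case: r h {cr} => x y /= ->.
have [e' e'E] : exists e' : R, e = e'%:C%C.
  exists (complex.Re e); move: e0; rewrite ltcE => /andP[/eqP h _].
  by case: e h {eU} => x y /= ->.
have r'0 : 0 < r' by move: r0; rewrite r'E ltcR.
have e'0 : 0 < e' by move: e0; rewrite e'E ltcR.
have [s [s0 sr se]] : exists s : R, [/\ 0 < s, s < r' & s < e'].
  by exists (Num.min r' e' / 2); case: (leP r' e') => h; split; lra.
exists c, s; split => //.
  have [|M cM] := @cvg_coef_bound c (s%:C%C).
    have := cr (w + s%:C%C); rewrite addrC addKr => h; apply/cvg_ex.
    exists (g (w + s%:C%C)); apply: h.
    by rewrite r'E; apply: lt_complexes; rewrite normc_real gtr0_norm.
  by exists M => k; have := cM k; rewrite normc_real gtr0_norm//; lra.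
move=> z z1 zw eta eta0.
have Uz : U z.
  apply: eU; rewrite -ball_normE /= distrC e'E.
  by apply: lt_complexes; lra.
have z1' : `|z : complexes R| < 1 by exact: (@lt_complexes z 1).
have h1 : power_series c (z - w) @ \oo --> g z.
  by apply: cr; rewrite r'E; apply: lt_complexes; lra.
have h2 : power_series (a : nat -> complexes R) z @ \oo --> g z.
  by have h := acvg z z1'; rewrite gf.
have eta2 : 0 < (eta / 2)%:C%C :> complexes R by rewrite ltcR; lra.
have /cvgrPdist_lt/(_ _ eta2)[N1 _ N1P] := h1.
have /cvgrPdist_lt/(_ _ eta2)[N2 _ N2P] := h2.
exists (maxn N1 N2) => L; rewrite geq_max => /andP[/N1P l1 /N2P l2].
have {}l1 : normc (g z - (trunc c L).[z - w]) < eta / 2.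
  by rewrite normc_lt -power_series_trunc.
have {}l2 : normc (g z - (trunc a L).[z]) < eta / 2.
  by rewrite normc_lt -power_series_trunc.
set A := (trunc a L).[z] in l2 *; set C := (trunc c L).[z - w] in l1 *.
have h : A - C = (g z - C : R[i]) - (g z - A) by move: (g z : R[i]) => G; ring.
by rewrite h; apply: le_trans (le_normcD _ _) _; rewrite normcN; lra.
Qed.

End PowerSeries.

(** * A polynomial map of the disk bulging out of it *)

(** Consecutive central binomial coefficients have ratio 2 (2k + 1)/(k + 1), which is at least 4 (k
    + 1)/(k + 2). *)
Lemma leq_exp4_central_bin k : (4 ^ k <= k.+1 * 'C(k.*2, k))%N.
Proof.
elim: k => [//|k IH].
have E1 : ((k.*2).+2 * 'C((k.*2).+1, k) = k.+1 * 'C((k.*2).+2, k.+1))%N.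
  exact: mul_bin_diag.
have E2 : ((k.*2).+1 * 'C(k.*2, k) = k.+1 * 'C((k.*2).+1, k.+1))%N.
  exact: mul_bin_diag.
have E3 : 'C((k.*2).+1, k.+1) = 'C((k.*2).+1, k).
  rewrite -[RHS]bin_sub; last by lia.
  by congr 'C(_, _); lia.
rewrite -E3 in E1.
rewrite doubleS expnS; set x := 'C(_, _) in E1 *; set y := 'C(_, _) in E1 E2.
set z := 'C(_, _) in E2 IH.
rewrite -(@leq_pmul2l k.+1)//; nia.
Qed.

Lemma bernoulli_le (R : realType) (y : R) j : 0 <= y -> 1 + j%:R * y <= (1 + y) ^+ j.
Proof.
move=> y0; elim: j => [|j IH]; first by rewrite mul0r addr0 expr0.
rewrite exprS; apply: (@le_trans _ _ ((1 + y) * (1 + j%:R * y))); last first.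
  by rewrite ler_wpM2l// addr_ge0.
have j0 : 0 <= j%:R :> R by [].
rewrite -natr1; nra.
Qed.

Lemma geom_le_central_bin (R : realType) (q : R) : 0 < q < 1 ->
  exists2 k, (0 < k)%N & q ^+ k <= 'C(k.*2, k)%:R / 4 ^+ k / 4.
Proof.
move=> /andP[q0 q1]; pose y := q^-1 - 1.
have y0 : 0 < y by rewrite subr_gt0 invf_gt1.
have qy : q^-1 = 1 + y by rewrite addrC subrK.
(* At the exponent 2j, squaring Bernoulli's inequality gives (1 + y)^(2j) >= (1 + j y)^2 >= 12 j >=
   4 (2j + 1), which beats the polynomial decay of the right-hand side. *)
pose j := (Num.truncn (12 / y ^+ 2)).+1.
have jy : 12 <= j%:R * y ^+ 2.
  rewrite -ler_pdivrMr ?exprn_gt0//; apply: ltW; exact: truncnS_gt.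
exists j.*2 => //.
have F0 : (j.*2.+1)%:R^-1 <= 'C(j.*2.*2, j.*2)%:R / 4 ^+ j.*2 :> R.
  rewrite ler_pdivlMr ?exprn_gt0// mulrC ler_pdivrMr ?ltr0n// mulrC -natrM.
  by rewrite -natrX ler_nat leq_exp4_central_bin.
apply: (@le_trans _ _ ((j.*2.+1)%:R^-1 / 4)); last by rewrite ler_pM2r.
rewrite -invfM -[leLHS]invrK lef_pV2 ?posrE ?invr_gt0 ?exprn_gt0 ?mulr_gt0 ?ltr0n//.
rewrite -exprVn qy -muln2 exprM.
have b := bernoulli_le j (ltW y0).
have j1 : 1 <= j%:R :> R by rewrite ler1n.
apply: (@le_trans _ _ ((1 + j%:R * y) ^+ 2)); last first.
  by rewrite lerXn2r// nnegrE ?exprn_ge0; nra.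
rewrite -natr1 natrM; nra.
Qed.

Lemma sum_symmetric (V : zmodType) (k : nat) (F : nat -> V) :
  (forall j, (j <= k)%N -> F (k - j)%N = F (k + j)%N) ->
  \sum_(i < k.*2.+1) F i = F k + \sum_(j < k) F (k + j.+1)%N *+ 2.
Proof.
move=> sym; rewrite (_ : k.*2.+1 = (k + k.+1)%N) -?addnn -?addnS//.
rewrite big_split_ord /= big_ord_recl /= addn0 addrCA; congr (_ + _).
rewrite (reindex_inj rev_ord_inj) /= -big_split; apply: eq_bigr => j _ /=.
by rewrite mulr2n sym// /bump /= add1n.
Qed.

Section PeakPolynomial.
Variable R : realType.

Lemma unit_conj (xi : R[i]) : normc xi = 1 -> xi * xi^*%C = 1.
Proof.
move=> h; have := normc_sqE xi; rewrite h expr1n; case: xi {h} => a b /= e.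
by apply/eqP; rewrite eq_complex /=; apply/andP; split; apply/eqP; lra.
Qed.

(* The positive trigonometric polynomial |1 + xi|^2k, which is concentrated near
   xi = 1; on the unit circle |1 + xi|^2 = 4 - |xi - 1|^2. *)
Lemma Re_kernel (xi : R[i]) k : normc xi = 1 ->
  'C(k.*2, k)%:R + \sum_(j < k) ('C(k.*2, k + j.+1)%:R * complex.Re (xi ^+ j.+1)) *+ 2
  = (4 - normc (xi - 1) ^+ 2) ^+ k.
Proof.
move=> xi1; have xic := unit_conj xi1.
have e1 : (1 + xi) ^+ 2 * xi^*%C = (4 - normc (xi - 1) ^+ 2)%:C%C.
  have := normc_sqE xi; rewrite xi1 expr1n normc_sqE.
  have -> : (1 + xi) ^+ 2 * xi^*%C = xi^*%C + 2 * (xi * xi^*%C) + xi * (xi * xi^*%C).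
    by ring.
  rewrite xic !mulr1; case: xi {xi1 xic} => a b /= e.
  by apply/eqP; rewrite eq_complex /=; apply/andP; split; apply/eqP; lra.
have : complex.Re (((1 + xi) ^+ 2 * xi^*%C) ^+ k) = (4 - normc (xi - 1) ^+ 2) ^+ k.
  by rewrite e1 -rmorphXn.
move=> <-; rewrite exprMn -exprM mul2n exprDn mulr_suml raddf_sum /=.
pose F i : R := complex.Re (xi ^+ i * xi^*%C ^+ k) *+ 'C(k.*2, i).
have FE j : F (k + j)%N = complex.Re (xi ^+ j) *+ 'C(k.*2, k + j).
  by rewrite /F exprD mulrAC -exprMn xic expr1n mul1r.
rewrite [RHS](_ : _ = \sum_(i < k.*2.+1) F i); last first.
  by apply: eq_bigr => i _; rewrite expr1n mul1r mulrnAl raddfMn.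
rewrite (sum_symmetric (F := F)).
  rewrite -[in F k](addn0 k) FE addn0 expr0; congr (_ + _).
  by apply: eq_bigr => j _; rewrite FE mulr_natl.
move=> j jk; rewrite FE /F.
rewrite (_ : xi ^+ (k - j) * _ = xi^*%C ^+ j); last first.
  rewrite -{2}(subnK jk) exprD mulrA -exprMn xic expr1n mul1r//.
rewrite -rmorphXn (_ : 'C(_, k - j) = 'C(k.*2, k + j)).
  by congr (_ *+ _); case: (xi ^+ j).
by rewrite -bin_sub; [congr 'C(_, _)|]; lia.
Qed.

(** T is the analytic part of the kernel of [Re_kernel], doubled, centred at w, scaled by 4^-k and
    stripped of its constant term. On the circle its real part is (1 - |z - w|^2/4)^k - F0, and k
    makes the first term at most F0/4 away from w; hence u = min(1, F0/4). *)
Lemma peak_polynomial (w : R[i]) (d : R) : normc w = 1 -> 0 < d <= 1 ->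
  exists k (T : {poly R[i]}) (u : R),
  [/\ (0 < k)%N, (size T <= k.+1)%N, T`_0 = 0, 0 < u <= 1 &
   forall z, normc z = 1 -> d <= normc (z - w) ->
     complex.Re T.[z] <= - (3 * u)].
Proof.
move=> w1 /andP[d0 d1].
have [|k k0 kP] := @geom_le_central_bin R (1 - d ^+ 2 / 4); first by apply/andP; split; nra.
pose F0 : R := 'C(k.*2, k)%:R / 4 ^+ k.
have p4 : 0 < 4 ^+ k :> R by rewrite exprn_gt0.
have F00 : 0 < F0 by rewrite divr_gt0// ltr0n bin_gt0 -addnn leq_addr.
pose T : {poly R[i]} := \poly_(i < k.+1)
  (if i == 0%N then 0 else (('C(k.*2, k + i)%:R * 2 / 4 ^+ k)%:C%C * (w^*%C) ^+ i)).
exists k, T, (Num.min 1 (F0 / 4)); split => //.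
- exact: size_poly.
- by rewrite coef_poly.
- by case: (leP 1 (F0 / 4)) => h; lra.
move=> z z1 zw.
pose xi := w^*%C * z.
have ww := unit_conj w1.
have wc1 : normc (w^*%C) = 1 by rewrite -w1; case: (w) => a b /=; rewrite sqrrN.
have xi1 : normc xi = 1 by rewrite normcM wc1 z1 mulr1.
have xw : normc (xi - 1) = normc (z - w).
  by rewrite -[LHS]mul1r -w1 -normcM mulrBr mulrA ww mul1r mulr1.
have TE : complex.Re T.[z] =
    \sum_(j < k) (('C(k.*2, k + j.+1)%:R * complex.Re (xi ^+ j.+1)) *+ 2) / 4 ^+ k.
  have -> : T.[z] = \sum_(j < k) ('C(k.*2, k + j.+1)%:R * 2 / 4 ^+ k)%:C%C * xi ^+ j.+1.
    rewrite horner_poly big_ord_recl eqxx mul0r add0r; apply: eq_bigr => j _.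
    by rewrite lift0 /xi exprMn [RHS]mulrA.
  rewrite raddf_sum; apply: eq_bigr => j _.
  case: (xi ^+ _) => x y /=; rewrite mul0r subr0 mulr2n; field.
  by rewrite expf_neq0.
have K := Re_kernel k xi1; rewrite xw in K.
have TE' : complex.Re T.[z] = (1 - normc (z - w) ^+ 2 / 4) ^+ k - F0.
  rewrite TE -mulr_suml (_ : 1 - _ = (4 - normc (z - w) ^+ 2) / 4); last by field.
  by rewrite expr_div_n -K mulrDl addrAC subrr add0r.
have h : (1 - normc (z - w) ^+ 2 / 4) ^+ k <= F0 / 4.
  have N2 : normc (z - w) <= 2.
    by apply: le_trans (le_normcD _ _) _; rewrite normcN z1 w1; lra.
  have N0 := normc_ge0 (z - w); set N := normc (z - w) in N0 N2 zw *.
  have a0 : 0 <= 1 - N ^+ 2 / 4 by nra.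
  have ab : 1 - N ^+ 2 / 4 <= 1 - d ^+ 2 / 4 by nra.
  by apply: le_trans kP; rewrite lerXn2r// nnegrE// (le_trans a0).
by rewrite TE'; case: (leP 1 (F0 / 4)) => h'; lra.
Qed.

End PeakPolynomial.

(** * Taylor coefficients of a composite *)

Section CompositionCoefficients.
Variable R : realType.
Implicit Types (f p q : {poly R[i]}) (z y : R[i]).

Lemma coef_XaddC_exp (F : comNzRingType) (z : F) i j :
  (('X + z%:P) ^+ i)`_j = z ^+ (i - j) *+ 'C(i, j).
Proof.
elim: i j => [|i IH] j.
  by rewrite expr0 coef1 bin0n; case: j => //= j; rewrite sub0n expr0.
rewrite exprS mulrDl coefD coefXM coefCM; case: j => [|j] /=.
  by rewrite add0r IH !bin0 !subn0 -exprS.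
rewrite !IH binS subSS mulrnDr addrC; congr (_ + _).
rewrite mulrnAr; case: (ltnP j i) => ji; last by rewrite bin_small ?mulr0n.
by rewrite -exprS subnSK.
Qed.

Lemma coef_comp_XaddC (F : comNzRingType) (p : {poly F}) (z : F) j :
  (p \Po ('X + z%:P))`_j = p^`N(j).[z].
Proof.
rewrite -{2}[p]coefK poly_def linear_sum /= horner_sum comp_polyE coef_sum.
apply: eq_bigr => i _; rewrite coefZ coef_XaddC_exp linearZ /= hornerZ nderivnXn.
by rewrite hornerMn hornerXn.
Qed.

Lemma nderivn_nderivn (F : comNzRingType) (p : {poly F}) n j :
  p^`N(n)^`N(j) = p^`N(n + j) *+ 'C(n + j, n).
Proof.
apply/polyP => i; rewrite coefMn !coef_nderivn addnA -!mulrnA; congr (_ *+ _).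
have f0 : (0 < n`! * (j`! * i`!))%N by rewrite !muln_gt0 !fact_gt0.
apply/eqP; rewrite -(eqn_pmul2r f0); apply/eqP.
have e1 := @bin_fact (n + j + i) n; have e2 := @bin_fact (j + i) j.
have e3 := @bin_fact (n + j + i) (n + j); have e4 := @bin_fact (n + j) n.
rewrite -addnA leq_addr addKn in e1; rewrite leq_addr addKn in e2.
rewrite leq_addr addKn in e3; rewrite leq_addr addKn in e4.
have {}e1 := e1 isT; have {}e2 := e2 isT; have {}e3 := e3 isT; have {}e4 := e4 isT.
rewrite -addnA in e3 *.
transitivity ((n + (j + i))`!)%N; [rewrite -e1 -e2|rewrite -e3 -e4]; ring.
Qed.

Lemma bin_mul_expr_le (x y : R) n j : 0 <= x -> 0 <= y ->
  'C(n + j, n)%:R * (x ^+ n * y ^+ j) <= (x + y) ^+ (n + j).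
Proof.
move=> x0 y0; rewrite exprDn.
have h : (j < (n + j).+1)%N by rewrite ltnS leq_addl.
rewrite (bigD1 (Ordinal h))//= addnK -(@bin_sub (n + j) n) ?leq_addr// addKn mulr_natl.
by rewrite lerDl sumr_ge0// => i _; rewrite mulrn_wge0// mulr_ge0 ?exprn_ge0.
Qed.

(* The Taylor coefficients of the composite at the points of the circle of
   radius s grow at most like delta^-n; the Cauchy estimates on that circle then
   bound the Taylor coefficients at 0, as for a radius of convergence s + delta. *)
Lemma comp_coef_bound f phi (s delta R1 r M : R) kap m :
  0 <= s -> 0 < delta -> s + delta = 1 -> 0 < R1 -> R1 < r -> 0 <= M ->
  (forall y, normc y = s -> wnorm delta ((phi \Po ('X + y%:P)) - phi.[y]%:P) <= R1) ->
  (forall y, normc y = s -> forall j, (j <= kap + m)%N ->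
    normc (f \Po ('X + (phi.[y])%:P))`_j * r ^+ j <= M) ->
  normc (f^`N(kap) \Po phi)`_m <= m.+1%:R ^+ 2 * M * (r - R1) ^- kap.
Proof.
move=> s0 d0 sd R10 R1r M0 phiP fP.
have rR : 0 < r - R1 by lra.
have r0 : 0 < r by lra.
set G := f^`N(kap) \Po phi; set M' := M * (r - R1) ^- kap.
have M'0 : 0 <= M' by rewrite mulr_ge0// invr_ge0 exprn_ge0// ltW.
(* Shrinking the radius from r to [R1] absorbs the binomial produced by the derivative, at the cost
   (r - [R1])^-kap. *)
have tayP y j : normc y = s -> (j <= m)%N ->
    normc (f^`N(kap) \Po ('X + (phi.[y])%:P))`_j * R1 ^+ j <= M'.
  move=> ys jm; rewrite coef_comp_XaddC nderivn_nderivn hornerMn -mulr_natl normcM normc_nat.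
  have h := fP y ys (kap + j)%N; rewrite leq_add2l coef_comp_XaddC in h.
  have {}h := h jm; have b := bin_mul_expr_le kap j (ltW rR) (ltW R10).
  rewrite subrK in b; set N := normc _ in h *.
  rewrite /M' ler_pdivlMr ?exprn_gt0//; apply: le_trans h.
  have N0 : 0 <= N by exact: normc_ge0.
  by have := ler_wpM2l N0 b; congr (_ <= _); ring.
have GP y n : normc y = s -> (n <= m)%N ->
    normc (G^`N(n)).[y] <= n.+1%:R * M' * delta ^- n.
  move=> ys nm; rewrite -coef_comp_XaddC /G -comp_polyA.
  set D := (phi \Po ('X + y%:P)) - phi.[y]%:P.
  have DR : wnorm delta D <= R1 by exact: phiP.
  have -> : phi \Po ('X + y%:P) = ('X + (phi.[y])%:P) \Po D.
    by rewrite comp_polyD comp_polyX comp_polyC subrK.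
  rewrite comp_polyA; set P := _ \Po ('X + _).
  have D0 : 'X %| D.
    rewrite -['X]subr0 -polyC0 dvdp_XsubCl /root /D hornerD hornerN horner_comp.
    by rewrite !hornerE subrr.
  rewrite comp_polyE coef_sum ler_pdivlMr ?exprn_gt0//.
  pose S := maxn (size P) n.+1.
  (* D vanishes at 0, so D^i reaches the coefficient n only for i <= n. *)
  have -> : \sum_(i < size P) (P`_i *: D ^+ i)`_n = \sum_(i < n.+1) P`_i * (D ^+ i)`_n.
    transitivity (\sum_(i < S) P`_i * (D ^+ i)`_n).
      rewrite (big_ord_widen S (fun i => (P`_i *: D ^+ i)`_n)) ?leq_maxl//.
      rewrite big_mkcond; apply: eq_bigr => i _; case: ltnP => h.
        by rewrite coefZ.
      by rewrite nth_default ?mul0r.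
    rewrite [RHS](big_ord_widen S (fun i => P`_i * (D ^+ i)`_n)) ?leq_maxr//.
    rewrite [RHS]big_mkcond; apply: eq_bigr => i _; case: ltnP => // h.
    have /dvdpP[E ->] : 'X^i %| D ^+ i by rewrite dvdp_exp2r.
    by rewrite coefMXn h mulr0.
  have dn : 0 <= delta ^+ n by rewrite exprn_ge0// ltW.
  apply: le_trans (ler_wpM2r dn (ler_normc_sum _ _ _)) _.
  rewrite mulr_suml -[X in X%:R]card_ord mulr_natl -sumr_const.
  apply: ler_sum => i _; rewrite normcM.
  apply: (@le_trans _ _ (normc P`_i * R1 ^+ i)).
    rewrite -mulrA ler_wpM2l ?normc_ge0//.
    apply: le_trans (normc_coef_le _ _ (ltW d0)) _.
    apply: le_trans (wnorm_exp _ _ (ltW d0)) _.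
    by rewrite lerXn2r// nnegrE ?(ltW R10)// wnorm_ge0// ltW.
  by apply: tayP => //; rewrite (leq_trans _ nm)// -ltnS.
(* The coefficient m - n of the n-th divided derivative of G is C(m, n) times the coefficient m of
   G; summing over n rebuilds (s + delta)^m = 1. *)
have key n : (n <= m)%N ->
    normc G`_m * (s ^+ (m - n) * delta ^+ n) *+ 'C(m, n) <= m.+1%:R * M'.
  move=> nm; have := @cauchy_estimate _ (G^`N(n)) s (n.+1%:R * M' * delta ^- n) (m - n) s0.
  have h y : normc y = s -> normc (G^`N(n)).[y] <= n.+1%:R * M' * delta ^- n.
    by move=> ys; apply: GP.
  move=> /(_ h); rewrite coef_nderivn subnKC// -[_ *+ 'C(m, n)]mulr_natl normcM normc_nat.
  rewrite ler_pdivlMr ?exprn_gt0// => h'.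
  apply: (@le_trans _ _ (n.+1%:R * M')); last by rewrite ler_wpM2r// ler_nat ltnS.
  apply: le_trans h'; rewrite -[leLHS]mulr_natl le_eqVlt; apply/orP; left; apply/eqP; ring.
have : normc G`_m * (s + delta) ^+ m <= m.+1%:R * (m.+1%:R * M').
  rewrite exprDn mulr_sumr -[X in X%:R * (_ * _)]card_ord mulr_natl -sumr_const.
  apply: ler_sum => n _; rewrite mulrnAr; apply: key.
  by rewrite -ltnS.
by rewrite sd expr1n mulr1 expr2 -!mulrA.
Qed.

End CompositionCoefficients.

Section Perturbation.
Variable R : realType.
Implicit Types (T : {poly R[i]}) (e u s : R) (y z w : R[i]).

Lemma eps_exists (s : seq R) : all (fun x => 0 <= x) s ->
  exists2 e : R, 0 < e & all (fun x => e * x <= 1) s.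
Proof.
move=> s0; have S0 : 0 <= \sum_(x <- s) x by rewrite big_seq sumr_ge0// => x /(allP s0).
exists (1 + \sum_(x <- s) x)^-1; first by rewrite invr_gt0; lra.
apply/allP => x xs; rewrite mulrC ler_pdivrMr ?mul1r; last by lra.
apply: (@le_trans _ _ (\sum_(x <- s) x)); last by lra.
rewrite (big_rem x)//= lerDl big_seq sumr_ge0// => z /mem_rem zs.
exact: (allP s0).
Qed.

(** The square of the right-hand side exceeds |1 + z|^2 by |z|^2 + (Re z + |z|^2)^2. To first order
    only Re z matters. *)
Lemma normc_1D z : normc (1 + z) <= 1 + complex.Re z + normc z ^+ 2.
Proof.
have := Re_le_normc (- z); rewrite normcN => h.
have n0 := normc_ge0 z; have := normc_sqE (1 + z); have := normc_sqE z.
have -> : complex.Re (1 + z) = 1 + complex.Re z by case: (z).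
have -> : complex.Im (1 + z) = complex.Im z by case: (z) => a b /=; rewrite add0r.
have hz : complex.Re (- z) = - complex.Re z by case: (z).
rewrite hz in h; set a := complex.Re z in h *; set b := complex.Im z.
set n := normc z in h n0 *; move=> e1 e2.
have p0 : 0 <= 1 + a + n ^+ 2 by nra.
by rewrite -(ler_pXn2r (_ : 0 < 2)%N) ?nnegrE ?normc_ge0// e2; nra.
Qed.

Lemma normc_scaleB s z : normc z = 1 -> s <= 1 ->
  normc (s%:C%C * z - z) = 1 - s.
Proof.
move=> z1 s1; have -> : s%:C%C * z - z = (s - 1)%:C%C * z.
  by rewrite rmorphB rmorph1 mulrBl mul1r.
by rewrite normcM z1 mulr1 normc_real ler0_norm ?opprB// subr_le0.
Qed.

Definition pert e T : {poly R[i]} := 1 + e%:C%C *: T.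

(** The dilation 1 + e u pushes the whole disk outwards; for T from [peak_polynomial], the factor 1
    + e T pulls it back except near w. *)
Definition bump_map u e T : {poly R[i]} := (1 + e * u)%:C%C *: ('X * pert e T).

Lemma horner_bump_map u e T y :
  (bump_map u e T).[y] = (1 + e * u)%:C%C * (y * (1 + e%:C%C * T.[y])).
Proof. by rewrite /bump_map /pert !hornerE. Qed.

(** [bump_map] is the identity up to O(e), so on a disk of radius e C0 contained in the unit disk
    its increment is e C0 up to O(e^2). *)
Lemma bump_map_taylor u e T C0 K y : 0 <= u -> 0 <= e <= 1 -> 0 <= C0 -> e * C0 <= 1 ->
  normc y = 1 - e * C0 ->
  K = (size ('X * T))%:R * wnorm 1 T ->
  wnorm (e * C0) ((bump_map u e T \Po ('X + y%:P)) - (bump_map u e T).[y]%:P)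
  <= e * C0 + e ^+ 2 * (C0 * (u + K + u * K)).
Proof.
move=> u0 /andP[e0 e1] C00 eC ys KE.
have d0 : 0 <= e * C0 by rewrite mulr_ge0.
have K0 : 0 <= K by rewrite KE mulr_ge0// wnorm_ge0.
have T0 : 0 <= wnorm 1 T by rewrite wnorm_ge0.
set A := 'X * T.
have -> : bump_map u e T = (1 + e * u)%:C%C *: ('X + e%:C%C *: A).
  by rewrite /bump_map /pert mulrDr mulr1 -scalerAr.
rewrite -comp_polyCr !comp_polyZ !comp_polyD !comp_polyX !comp_polyZ -scalerBr.
rewrite wnormZ normc_real ger0_norm; last by rewrite addr_ge0// mulr_ge0.
have -> : 'X + y%:P + e%:C%C *: (A \Po ('X + y%:P)) - (y%:P + e%:C%C *: (A \Po y%:P))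
   = 'X + e%:C%C *: ((A \Po ('X + y%:P)) - (A \Po y%:P)).
  by rewrite -!mul_polyC; ring.
have hA : wnorm (e * C0) ((A \Po ('X + y%:P)) - (A \Po y%:P)) <= e * C0 * K.
  have := @wnorm_comp_sub _ (e * C0) A ('X + y%:P) y%:P 1 d0 (lexx _).
  rewrite addrK wnormX wnormC ys expr1n mulr1 /A wnormXM mul1r -/A -KE; apply.
    by apply: le_trans (wnormD _ _ d0) _; rewrite wnormX wnormC ys; lra.
  by lra.
have h : wnorm (e * C0) ('X + e%:C%C *: ((A \Po ('X + y%:P)) - (A \Po y%:P)))
    <= e * C0 * (1 + e * K).
  apply: le_trans (wnormD _ _ d0) _.
  rewrite wnormX wnormZ normc_real ger0_norm//.
  have := ler_wpM2l e0 hA; lra.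
have eu : 0 <= 1 + e * u by rewrite addr_ge0// mulr_ge0.
apply: le_trans (ler_wpM2l eu h) _.
have P : 0 <= e ^+ 2 * (C0 * (u * K)) * (1 - e) by rewrite !mulr_ge0 ?exprn_ge0// subr_ge0.
rewrite -subr_ge0; apply: le_trans P _; rewrite le_eqVlt; apply/orP; left; apply/eqP; ring.
Qed.

Lemma bump_map_le u e T s y : 0 <= u -> 0 <= e -> normc y = s -> s <= 1 ->
  normc (bump_map u e T).[y] <= (1 + e * u) * s * (1 + e * wnorm 1 T).
Proof.
move=> u0 e0 ys s1; have s0 : 0 <= s by rewrite -ys normc_ge0.
have eu : 0 <= 1 + e * u by rewrite addr_ge0// mulr_ge0.
rewrite horner_bump_map !normcM normc_real ger0_norm// ys mulrA ler_wpM2l ?mulr_ge0//.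
apply: le_trans (le_normcD _ _) _; rewrite normc_1 normcM normc_real ger0_norm//.
by rewrite lerD2l ler_wpM2l// normc_horner_le// ys.
Qed.

Lemma bump_map_near u e T s y w : 0 <= u <= 1 -> 0 <= e <= 1 -> normc y = s -> 0 < s <= 1 ->
  normc ((bump_map u e T).[y] - w)
  <= e * (u + 2 * wnorm 1 T) + (1 - s) + normc (s^-1%:C%C * y - w).
Proof.
move=> /andP[u0 u1] /andP[e0 e1] ys /andP[s0 s1].
set z := s^-1%:C%C * y.
have yE : y = s%:C%C * z.
  by rewrite /z mulrA -rmorphM /= divff ?mul1r// gt_eqF.
have nz : normc z = 1.
  by rewrite /z normcM ys normc_real gtr0_norm ?invr_gt0// mulVf// gt_eqF.
have -> : (bump_map u e T).[y] - w = ((bump_map u e T).[y] - y) + ((y - z) + (z - w)) by ring.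
apply: le_trans (le_normcD _ _) _; rewrite -[leRHS]addrA; apply: lerD; last first.
  apply: le_trans (le_normcD _ _) _; apply: lerD => //.
  by rewrite {1}yE normc_scaleB.
rewrite horner_bump_map.
have -> : (1 + e * u)%:C%C * (y * (1 + e%:C%C * T.[y])) - y
    = y * ((e * u)%:C%C + (e * (1 + e * u))%:C%C * T.[y]).
  by rewrite !(rmorphD, rmorphM, rmorph1) /=; ring.
have T0 : 0 <= wnorm 1 T by rewrite wnorm_ge0.
have Ty : normc T.[y] <= wnorm 1 T by rewrite normc_horner_le// ys.
have h : normc ((e * u)%:C%C + (e * (1 + e * u))%:C%C * T.[y]) <= e * (u + 2 * wnorm 1 T).
  apply: le_trans (le_normcD _ _) _; rewrite normcM !normc_real !ger0_norm ?mulr_ge0//; last first.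
    by rewrite addr_ge0// mulr_ge0.
  have h1 : (1 + e * u) * normc T.[y] <= 2 * wnorm 1 T.
    by rewrite ler_pM ?normc_ge0// ?addr_ge0 ?mulr_ge0//; nra.
  by have := ler_wpM2l e0 h1; lra.
by rewrite normcM ys; have := normc_ge0 ((e * u)%:C%C + (e * (1 + e * u))%:C%C * T.[y]); nra.
Qed.

(** By [normc_1D], to first order the factor 1 + e T loses 3 e u and the dilation gives back e u, a
    net loss of 2 e u. The other terms come from moving y to the unit circle and from the square in
    [normc_1D]. *)
Lemma bump_map_far u e T s y : 0 <= u <= 1 -> 0 <= e <= 1 -> normc y = s -> 0 < s <= 1 ->
  complex.Re T.[s^-1%:C%C * y] <= - (3 * u) ->
  normc (bump_map u e T).[y] <=
  s * (1 - e * (2 * u) + (2 * e) * ((1 - s) * ((size T)%:R * wnorm 1 T) + e * wnorm 1 T ^+ 2)).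
Proof.
move=> /andP[u0 u1] /andP[e0 e1] ys /andP[s0 s1].
set z := s^-1%:C%C * y => Tz.
have yE : y = s%:C%C * z.
  by rewrite /z mulrA -rmorphM /= divff ?mul1r// gt_eqF.
have nz : normc z = 1.
  by rewrite /z normcM ys normc_real gtr0_norm ?invr_gt0// mulVf// gt_eqF.
have T0 : 0 <= wnorm 1 T by rewrite wnorm_ge0.
have Ty : normc T.[y] <= wnorm 1 T by rewrite normc_horner_le// ys.
have dT : normc (T.[y] - T.[z]) <= (1 - s) * ((size T)%:R * wnorm 1 T).
  have := @wnorm_comp_sub _ 1 T y%:P z%:P 1 ler01 (lexx _).
  rewrite !comp_polyCr -!polyCB !wnormC expr1n mulr1 ys nz => /(_ s1 (lexx _)).
  have -> // : normc (y - z) = 1 - s.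
  by rewrite {1}yE normc_scaleB.
set D := (1 - s) * _ in dT *.
have D0 : 0 <= D by apply: le_trans dT; exact: normc_ge0.
have ReT : complex.Re T.[y] <= - (3 * u) + D.
  have := Re_le_normc (T.[y] - T.[z]); rewrite raddfB /=; lra.
rewrite horner_bump_map !normcM ys normc_real ger0_norm; last by rewrite addr_ge0// mulr_ge0.
rewrite mulrCA ler_wpM2l ?(ltW s0)//.
have n1 : normc (1 + e%:C%C * T.[y]) <= 1 + e * (- (3 * u) + D) + e ^+ 2 * wnorm 1 T ^+ 2.
  apply: le_trans (normc_1D _) _; rewrite normcM normc_real ger0_norm// exprMn.
  have -> : complex.Re (e%:C%C * T.[y]) = e * complex.Re T.[y].
    by case: (T.[y]) => p q /=; rewrite mul0r subr0.
  rewrite lerD// ?lerD2l ?ler_wpM2l ?exprn_ge0// lerXn2r// nnegrE ?normc_ge0//.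
have eu : 0 <= 1 + e * u by rewrite addr_ge0// mulr_ge0.
apply: le_trans (ler_wpM2l eu n1) _.
set W := wnorm 1 T ^+ 2; have W0 : 0 <= W by rewrite exprn_ge0.
have h1 : 0 <= (1 - e * u) * (e * D + e ^+ 2 * W).
  have eu1 : 0 <= 1 - e * u by nra.
  apply: mulr_ge0 => //; apply: addr_ge0; apply: mulr_ge0 => //.
  exact: exprn_ge0.
have h2 : 0 <= 3 * (e * u) ^+ 2 by rewrite mulr_ge0// exprn_ge0// mulr_ge0.
rewrite -subr_ge0; apply: le_trans (addr_ge0 h1 h2) _.
rewrite le_eqVlt; apply/orP; left; apply/eqP; ring.
Qed.

End Perturbation.

(** * Decay of Hankel determinants *)

Section HankelEstimate.
Variable R : realType.
Implicit Types (a : nat -> R[i]) (T : {poly R[i]}) (w : R[i]).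

(** [comp_coef_bound] is applied on the circle of radius s = 1 - e C0 with Taylor radius e C0. For
    small e this circle is sent inside the unit disk, each point landing near w or at distance more
    than r from the unit circle, which are the two cases of [taylor_bound]. *)
Lemma continued_coef_bound a w : normc w = 1 -> disk_bounded a -> continues_at a w ->
  exists k T (u : R), [/\ (0 < k)%N, (size T <= k.+1)%N, T`_0 = 0, 0 < u <= 1 &
  exists2 e0 : R, 0 < e0 & forall e, 0 < e <= e0 -> exists M B : R,
    [/\ 0 <= M, 0 <= B & forall kap m, exists L0, forall L, (L0 <= L)%N ->
      normc ((trunc a L)^`N(kap) \Po bump_map u e T)`_m
      <= m.+1%:R ^+ 2 * M * B ^+ kap]].
Proof.
move=> w1 ab cw; have [d d0 TB] := taylor_bound ab cw.
have [d' [d'0 d'1 d'd]] : exists d' : R, [/\ 0 < d', d' <= 1 & d' <= d / 2].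
  by exists (Num.min 1 (d / 2)); case: (leP 1 (d / 2)) => h; split; lra.
have [|k [T [u [k0 sT T00 uE peak]]]] := @peak_polynomial R w d' w1; first by rewrite d'0.
have /andP[u0 u1] := uE; exists k, T, u; split => //.
have [tau tauE] : exists tau, tau = wnorm 1 T by exists (wnorm 1 T).
have tau0 : 0 <= tau by rewrite tauE wnorm_ge0.
have [KA KAE] : exists x, x = (size ('X * T)%R)%:R * wnorm 1 T by eexists.
have KA0 : 0 <= KA by rewrite KAE mulr_ge0// wnorm_ge0.
have [KT KTE] : exists x, x = (size T)%:R * wnorm 1 T by eexists.
have KT0 : 0 <= KT by rewrite KTE mulr_ge0// wnorm_ge0.
(* The contraction e C0 outweighs the dilation and the perturbation, at most e (u + tau) to first
   order: this gives rho < 1. *)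
have [C0 C0E] : exists x, x = tau + u + 1 by eexists.
have C00 : 0 < C0 by lra.
have [K6 K6E] : exists x, x = C0 * (u + KA + u * KA) by eexists.
have K60 : 0 <= K6 by rewrite K6E mulr_ge0 ?addr_ge0 ?mulr_ge0 ?(ltW u0) ?(ltW C00).
have [K4 K4E] : exists x, x = C0 * KT + tau ^+ 2 by eexists.
have K40 : 0 <= K4 by rewrite K4E addr_ge0 ?mulr_ge0 ?exprn_ge0 ?(ltW C00).
(* In order: e <= 1, s >= 1/2, a cross term in rho, images within d of w, sigma < 1, and r <= d. *)
pose cs : seq R := [:: 1; 2 * C0; 2 * (u * tau); 2 * (u + 2 * tau + C0) / d;
  (2 * K4 + 2 * (C0 * u) + K6 + 1) / u; (C0 + K6 + 1) / d].
have ut0 : 0 <= u * tau by rewrite mulr_ge0// ltW.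
have C0u : 0 <= C0 * u by rewrite mulr_ge0// ltW.
have [|e0 e00 /= eP] := @eps_exists R cs.
  by rewrite /= ler01 !divr_ge0 ?(ltW d0) ?(ltW u0)//; try lra; rewrite ?andbT/=; lra.
exists e0 => // e /andP[e_gt0 ee0].
have {eP} [h1 [h2 h3 h4 h5 h6]] : e * 1 <= 1 /\ [/\ e * (2 * C0) <= 1, e * (2 * (u * tau)) <= 1,
   e * (2 * (u + 2 * tau + C0)) <= d, e * (2 * K4 + 2 * (C0 * u) + K6 + 1) <= u &
   e * (C0 + K6 + 1) <= d].
  have mono x : 0 <= x -> e0 * x <= 1 -> e * x <= 1.
    by move=> x0; apply: le_trans; rewrite ler_wpM2r.
  move: eP; rewrite andbT => /and5P[a1 a2 a3 a4 /andP[a5 a6]].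
  split; first by apply: mono.
  split.
  - by apply: mono => //; lra.
  - by apply: mono => //; lra.
  - by rewrite -[leRHS]mul1r -ler_pdivrMr// -mulrA mono// divr_ge0//; lra.
  - by rewrite -[leRHS]mul1r -ler_pdivrMr// -mulrA mono// divr_ge0//; lra.
  - by rewrite -[leRHS]mul1r -ler_pdivrMr// -mulrA mono// divr_ge0//; lra.
have e1 : e <= 1 by lra.
have eE : 0 <= e <= 1 by rewrite ltW.
have e2 : 0 < e ^+ 2 by rewrite exprn_gt0.
have e2e : e ^+ 2 <= e by nra.
pose s : R := 1 - e * C0.
have sE : 0 < s <= 1 by rewrite /s; apply/andP; split; nra.
(* The gap r - [R1] = e^2 is the price of a derivative, hence the constant e^-2 for B. *)
pose R1 : R := e * C0 + e ^+ 2 * K6; pose r : R := R1 + e ^+ 2.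
pose rho : R := (1 + e * u) * s * (1 + e * tau).
pose sigma : R := s * (1 - e * (2 * u) + (2 * e) * (e * C0 * KT + e * tau ^+ 2)) + r.
have R10 : 0 < R1 by rewrite ltr_wpDr ?mulr_gt0// mulr_ge0// ltW.
have rd : 0 < r <= d.
  rewrite addr_gt0//= /r /R1; have := mulr_ge0 K60 (_ : 0 <= e - e ^+ 2).
  by rewrite subr_ge0 => /(_ e2e) ?; lra.
have rho1 : rho < 1.
  have p1 : (1 + e * u) * (1 + e * tau) <= 1 + e * (u + tau + 1 / 2).
    have := ler_wpM2l (ltW e_gt0) h3; lra.
  have s0 : 0 <= s by have /andP[/ltW] := sE.
  rewrite /rho mulrAC; apply: le_lt_trans (ler_wpM2r s0 p1) _.
  have q : 0 < u + tau + 1 / 2 by lra.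
  have := mulr_gt0 e2 (mulr_gt0 q C00); rewrite /s C0E; lra.
(* The terms e C0 of s and r cancel, leaving the loss 2 e u against terms of order e^2. *)
have sigma1 : sigma < 1.
  have E : sigma = 1 - e * (2 * u) + e * (e * (2 * K4 + 2 * (C0 * u) + K6 + 1)) - 2 * (e ^+ 2 * (e * (C0 * K4))).
    by rewrite /sigma /r /R1 /s K4E; ring.
  have t1 := ler_wpM2l (ltW e_gt0) h5.
  have t2 : 0 <= e ^+ 2 * (e * (C0 * K4)) by rewrite !mulr_ge0// ltW.
  have t3 : 0 < e * u by rewrite mulr_gt0.
  rewrite E; lra.
have [M M0 hM] := TB r rho sigma rd rho1 sigma1.
exists M, (e ^+ 2)^-1; split => //; first by rewrite invr_ge0 ltW.
move=> kap m; have [f fP] := choice hM.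
exists (\max_(j < (kap + m).+1) f j)%N => L LL.
have -> : (e ^+ 2)^-1 ^+ kap = (r - R1) ^- kap by rewrite exprVn /r addrC addKr.
have d1 : 0 < e * C0 by rewrite mulr_gt0.
apply: (@comp_coef_bound _ _ _ s (e * C0) R1 r M) => //.
- by have /andP[/ltW] := sE.
- by rewrite /s subrK.
- by rewrite /r ltrDl.
- move=> y ys; rewrite /R1 K6E.
  by apply: bump_map_taylor => //; lra.
move=> y ys j jkm; apply: fP.
- apply: leq_trans LL; rewrite -ltnS in jkm.
  exact: (leq_bigmax (Ordinal jkm)).
- by rewrite /rho tauE; apply: bump_map_le => //; have /andP[] := sE; lra.
have /andP[s0 s1] := sE.
case: (leP d' (normc (s^-1%:C%C * y - w))) => hz; [right|left].
  rewrite /sigma lerD2r tauE; have sC : e * C0 = 1 - s by rewrite /s; lra.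
  rewrite sC KTE; apply: bump_map_far => //; first lra.
  apply: peak => //; rewrite normcM ys normc_real gtr0_norm ?invr_gt0//.
  by rewrite mulVf// gt_eqF.
have uE' : 0 <= u <= 1 by lra.
apply: le_trans (bump_map_near T w uE' eE ys sE) _.
by rewrite -tauE /s; lra.
Qed.

Lemma pert_exp T k : exists2 C : R, 0 <= C & forall e, 0 <= e <= 1 ->
  wnorm 1 (pert e T ^+ k - pert (e * k%:R) T) <= e ^+ 2 * C.
Proof.
have T0 : 0 <= wnorm 1 T by rewrite wnorm_ge0.
elim: k => [|k [C C0 IH]].
  exists 0 => // e _; rewrite expr0 mulr0 /pert scale0r addr0 subrr wnorm0.
  by rewrite mulr0.
exists (C * (1 + wnorm 1 T) + k%:R * wnorm 1 T ^+ 2).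
  by rewrite addr_ge0// mulr_ge0// ?exprn_ge0// addr_ge0.
move=> e /andP[e0 e1].
set D := pert e T ^+ k - pert (e * k%:R) T.
have -> : pert e T ^+ k.+1 - pert (e * k.+1%:R) T =
    D * pert e T + (e ^+ 2 * k%:R)%:C%C *: T ^+ 2.
  rewrite /D /pert exprS -!mul_polyC -natr1.
  by rewrite !(rmorphD, rmorphM, rmorph1, rmorph_nat, rmorphXn) /=; ring.
have hD : wnorm 1 D <= e ^+ 2 * C by apply: IH; rewrite e0.
apply: le_trans (wnormD _ _ ler01) _; rewrite [leRHS]mulrDr; apply: lerD.
  apply: le_trans (wnormM _ _ ler01) _; rewrite [leRHS]mulrA.
  apply: ler_pM; rewrite ?wnorm_ge0//.
  apply: le_trans (wnormD _ _ ler01) _; rewrite wnorm1 wnormZ normc_real ger0_norm//.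
  by rewrite lerD2l; nra.
rewrite wnormZ normc_real ger0_norm ?mulr_ge0 ?exprn_ge0// mulrA.
by rewrite ler_wpM2l ?mulr_ge0 ?exprn_ge0// wnorm_exp.
Qed.

Lemma wnorm_bump_map T (u e : R) : 0 <= u <= 1 -> 0 <= e <= 1 -> e * wnorm 1 T <= 1 ->
  wnorm 1 (bump_map u e T) <= 4.
Proof.
move=> /andP[u0 u1] /andP[e0 e1] eT.
rewrite /bump_map wnormZ wnormXM mul1r normc_real ger0_norm; last first.
  by rewrite addr_ge0// mulr_ge0.
apply: (@le_trans _ _ (2 * 2)); last by lra.
apply: ler_pM; rewrite ?addr_ge0 ?mulr_ge0 ?wnorm_ge0//; first by nra.
apply: le_trans (wnormD _ _ ler01) _; rewrite wnorm1 wnormZ normc_real ger0_norm//.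
lra.
Qed.

(* To first order in e, the polynomial part of y^-k in the coordinate
   z = bump_map y is z^-k (1 + e k T). *)
Lemma pert_bump_map T k (u : R) : 0 <= u <= 1 ->
  exists2 C : R, 0 <= C & forall e, 0 <= e <= 1 -> e * wnorm 1 T <= 1 ->
  wnorm 1 ((pert (e * k%:R) T \Po bump_map u e T) - pert e T ^+ k) <= e ^+ 2 * C.
Proof.
move=> uE; have /andP[u0 u1] := uE; have [C C0 CP] := pert_exp T k.
have T0 : 0 <= wnorm 1 T by rewrite wnorm_ge0.
pose K : R := (size T)%:R * 4 ^+ size T * wnorm 1 T.
have K0 : 0 <= K by rewrite !mulr_ge0// exprn_ge0.
exists (k%:R * ((u + 2 * wnorm 1 T) * K) + C).
  by rewrite addr_ge0// !mulr_ge0// addr_ge0// mulr_ge0.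
move=> e eE eT; have /andP[e0 e1] := eE.
set phi := bump_map u e T.
have -> : (pert (e * k%:R) T \Po phi) - pert e T ^+ k =
    (e * k%:R)%:C%C *: ((T \Po phi) - (T \Po 'X)) - (pert e T ^+ k - pert (e * k%:R) T).
  rewrite comp_polyXr /pert comp_polyD comp_polyZ comp_polyC scalerBr -!mul_polyC.
  by ring.
apply: le_trans (wnormD _ _ ler01) _; rewrite wnormN [leRHS]mulrDr; apply: lerD; last exact: CP.
rewrite wnormZ normc_real ger0_norm ?mulr_ge0//.
have p4 := wnorm_bump_map uE eE eT.
have hX : wnorm 1 (phi - 'X) <= e * (u + 2 * wnorm 1 T).
  have -> : phi - 'X = 'X * ((e * u)%:C%C%:P + (e * (1 + e * u))%:C%C *: T).
    rewrite /phi /bump_map /pert -!mul_polyC.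
    by rewrite !(rmorphD, rmorphM, rmorph1) /=; ring.
  rewrite wnormXM mul1r; apply: le_trans (wnormD _ _ ler01) _.
  rewrite wnormC wnormZ !normc_real !ger0_norm ?mulr_ge0 ?addr_ge0 ?mulr_ge0//.
  have : 0 <= e * ((1 - e * u) * wnorm 1 T).
    by rewrite !mulr_ge0// subr_ge0; nra.
  lra.
have h := @wnorm_comp_sub _ 1 T phi 'X 4 ler01 _ p4 _.
have {}h : wnorm 1 ((T \Po phi) - (T \Po 'X)) <= e * (u + 2 * wnorm 1 T) * K.
  apply: le_trans (h _ _) _; rewrite ?wnormX ?ler1n//.
  by rewrite ler_wpM2r.
apply: le_trans (ler_wpM2l (mulr_ge0 e0 (ler0n R k)) h) _.
rewrite le_eqVlt; apply/orP; left; apply/eqP; ring.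
Qed.

(** The coefficients of sum_i c_i z^i f^(i) / i!, that is, the twist of f by the polynomial with
    coordinates c in the binomial basis. *)
Definition binomial_twist a (c : nat -> R[i]) n j : R[i] :=
  \sum_(i < n.+1) c i * (a j *+ 'C(j, i)).

Lemma coef_XnM_nderivn (F : comNzRingType) (p : {poly F}) i j :
  ('X^i * p^`N(i))`_j = p`_j *+ 'C(j, i).
Proof.
rewrite coefXnM coef_nderivn; case: ltnP => ij; first by rewrite bin_small.
by rewrite subnKC.
Qed.

Lemma wnorm_exp_le (r : R) (p : {poly R[i]}) n (b : R) : 0 <= r ->
  wnorm r p <= b -> wnorm r (p ^+ n) <= b ^+ n.
Proof.
move=> r0 pb; apply: le_trans (wnorm_exp _ _ r0) _.
by rewrite lerXn2r// nnegrE ?wnorm_ge0// (le_trans (wnorm_ge0 p r0)).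
Qed.

Lemma pert_inverse e T m : T`_0 = 0 -> 0 <= e -> e * wnorm 1 T <= 1 / 2 ->
  exists2 W : {poly R[i]}, 'X^(m.+1) %| pert e T * W - 1 & wnorm 1 W <= 2.
Proof.
move=> T0 e0 eT; pose x : {poly R[i]} := - (e%:C%C *: T).
have nT : 0 <= wnorm 1 T by rewrite wnorm_ge0.
exists (\sum_(i < m.+1) x ^+ i).
  have -> : pert e T * \sum_(i < m.+1) x ^+ i - 1 = - x ^+ m.+1.
    have -> : pert e T = - (x - 1) by rewrite /x /pert opprB opprK.
    by rewrite mulNr -subrX1 opprB addrAC subrr add0r.
  rewrite dvdpNr dvdp_exp2r// -['X]subr0 -polyC0 dvdp_XsubCl /root.
  by rewrite /x hornerN hornerZ horner_coef0 T0 mulr0 oppr0.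
have xn : wnorm 1 x <= 1 / 2 by rewrite wnormN wnormZ normc_real ger0_norm.
apply: le_trans (wnorm_sum _ _ _ ler01) _.
apply: (@le_trans _ _ (\sum_(i < m.+1) (1 / 2) ^+ i)).
  by apply: ler_sum => i _; apply: wnorm_exp_le.
apply: le_trans (geom_sum_le _ _) _; first by lra.
by rewrite (_ : 1 - 1 / 2 = 2^-1 :> R) ?invrK//; lra.
Qed.

(** The moment is the coefficient of z^m in Q^s g, where m = k s + t and g is the twist. In the
    coordinate y it carries rho^-m with rho = 1 + e u, while Q^s W^(ks) has, by [pert_bump_map],
    norm at most (1 + O(e^2))^s only; for small e the ratio is theta^s with theta < 1. *)
Lemma hankel_estimate a w : normc w = 1 -> disk_bounded a -> continues_at a w ->
  exists k (Q : {poly R[i]}) (theta A B : R),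
  [/\ (0 < k)%N, Q`_0 = 1, (size Q <= k.+1)%N, 0 <= theta < 1 & 0 <= A /\ 1 <= B] /\
  forall n c (X : R), (forall i, normc (c i) <= X) ->
  forall s t, (t < k.*2)%N ->
    normc (moment (fun i => binomial_twist a c n (k * s + t - i)%N) (Q ^+ s))
    <= A * B ^+ n * X * n.+1%:R * (k * s + t).+1%:R ^+ 2 * theta ^+ s.
Proof.
move=> w1 ab cw.
have [k [T [u [k0 sT T0 uE [e0 e00 eP]]]]] := continued_coef_bound w1 ab cw.
have /andP[u0 u1] := uE; have uE' : 0 <= u <= 1 by rewrite ltW.
have [C C0 CP] := pert_bump_map T k uE'.
have nT : 0 <= wnorm 1 T by rewrite wnorm_ge0.
have C2k : 0 <= C * 2 ^+ k by rewrite mulr_ge0// exprn_ge0.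
(* The third condition gives e^2 C 2^k < e u, hence [g1 < rho]. *)
have [|e1 e10 /= e1P] := @eps_exists R [:: 1; 2 * wnorm 1 T; 2 * (C * 2 ^+ k) / u].
  by rewrite /= ler01 !divr_ge0 ?mulr_ge0 ?(ltW u0).
have [e [e_gt0 ee0 ee1]] : exists e : R, [/\ 0 < e, e <= e0 & e <= e1].
  by exists (Num.min e0 e1); case: (leP e0 e1) => h; split; lra.
have [h1 h2 h3] : [/\ e * 1 <= 1, e * (2 * wnorm 1 T) <= 1 & e * (2 * (C * 2 ^+ k)) <= u].
  have mono x : 0 <= x -> e1 * x <= 1 -> e * x <= 1.
    by move=> x0; apply: le_trans; rewrite ler_wpM2r.
  move: e1P; rewrite andbT => /and3P[a1 a2 a3]; split.
  - exact: mono.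
  - by apply: mono => //; rewrite mulr_ge0.
  - by rewrite -[leRHS]mul1r -ler_pdivrMr// -mulrA mono// divr_ge0 ?mulr_ge0// ltW.
have eE : 0 <= e <= 1 by rewrite ltW//; lra.
have e_ge0 := ltW e_gt0.
have eT : e * wnorm 1 T <= 1 by lra.
have eT2 : e * wnorm 1 T <= 1 / 2 by lra.
have [M [B0 [M0 B00 MP]]] := eP e (introT andP (conj e_gt0 ee0)).
pose V := pert e T; pose phi := bump_map u e T; pose Q := pert (e * k%:R) T.
pose D := (Q \Po phi) - V ^+ k.
have DC : wnorm 1 D <= e ^+ 2 * C by apply: CP.
have phi4 : wnorm 1 phi <= 4 by apply: wnorm_bump_map.
pose g1 : R := 1 + e ^+ 2 * (C * 2 ^+ k).
pose rho : R := 1 + e * u.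
have rho1 : 1 <= rho by rewrite lerDl mulr_ge0// ltW.
have g10 : 0 < g1 by rewrite ltr_pwDl// mulr_ge0// exprn_ge0.
have g1rho : g1 < rho ^+ k.
  apply: (@lt_le_trans _ _ rho).
    rewrite ltrD2l expr2 -mulrA ltr_pM2l//; lra.
  by rewrite -[leLHS]expr1 ler_weXn2l.
have rk0 : 0 < rho ^+ k by rewrite exprn_gt0//; lra.
have VX0 : 0 <= wnorm 1 (V + 'X * V^`()) by rewrite wnorm_ge0.
exists k, Q, (g1 / rho ^+ k), (2 ^+ k.*2 * wnorm 1 (V + 'X * V^`()) * M), (4 * (1 + B0)).
split.
  split => //.
  - by rewrite /Q /pert coefD coefZ T0 mulr0 addr0 coef1.
  - rewrite /Q /pert (leq_trans (size_polyD _ _))// geq_max size_poly1 /=.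
    by rewrite (leq_trans (size_scale_leq _ _)).
  - by rewrite divr_ge0 ?(ltW g10) ?(ltW rk0)//= ltr_pdivrMr// mul1r.
  - by split; [rewrite !mulr_ge0// exprn_ge0|lra].
move=> n c X cX s t tk; set m := (k * s + t)%N.
have X0 : 0 <= X by apply: le_trans (cX 0%N); exact: normc_ge0.
have [f fP] := choice (fun ij : nat * nat => MP ij.1 ij.2).
(* One truncation serves the finitely many coefficients involved, and L > m makes it invisible up to
   order m. *)
pose L := maxn m.+1 (\max_(i < n.+1) \max_(j < m.+1) f (i : nat, j : nat)).
pose F i := (trunc a L)^`N(i).
have FP i j : (i <= n)%N -> (j <= m)%N ->
    normc (F i \Po phi)`_j <= m.+1%:R ^+ 2 * M * B0 ^+ i.
  move=> hi hj; apply: (@le_trans _ _ (j.+1%:R ^+ 2 * M * B0 ^+ i)).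
    apply: (fP (i, j)) => /=; rewrite /L leq_max; apply/orP; right.
    apply: leq_trans (leq_bigmax (Ordinal (hi : (i < n.+1)%N))) => /=.
    exact: (leq_bigmax (Ordinal (hj : (j < m.+1)%N))).
  rewrite !ler_wpM2r ?exprn_ge0// lerXn2r ?nnegrE// ler_nat ltnS//.
pose gL := \sum_(i < n.+1) c i *: ('X^i * F i).
have gLE j : (j <= m)%N -> gL`_j = binomial_twist a c n j.
  move=> jm; rewrite coef_sum; apply: eq_bigr => i _; rewrite coefZ coef_XnM_nderivn.
  by rewrite coef_poly (_ : (j < L)%N)// leq_max ltnS jm.
have sQs : (size (Q ^+ s) <= m.+1)%N.
  apply: leq_trans (size_poly_exp_leq _ _) _; rewrite ltnS /m.
  have : ((size Q).-1 <= k)%N.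
    have : (size Q <= k.+1)%N.
      rewrite /Q /pert (leq_trans (size_polyD _ _))// geq_max size_poly1 /=.
      by rewrite (leq_trans (size_scale_leq _ _)).
    by case: (size Q).
  by move=> h; rewrite (leq_trans (leq_mul h (leqnn s)))// leq_addr.
have momE : moment (fun i => binomial_twist a c n (m - i)%N) (Q ^+ s) = (Q ^+ s * gL)`_m.
  rewrite (momentE _ sQs) coefM; apply: eq_bigr => i _.
  by rewrite gLE// leq_subr.
rewrite momE.
have [W VW W2] := @pert_inverse e T m T0 e_ge0 eT2.
have V0 : V`_0 = 1 by rewrite /V /pert coefD coefZ T0 mulr0 addr0 coef1.
have := @coef_change_variable _ rho%:C%C V W (Q ^+ s * gL) m V0 VW.
rewrite -/(bump_map u e T) -/phi => cv.
(* The composite of Q with phi is V^k + D, and V W = 1 modulo y^(m+1). *)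
pose E := 1 + D * W ^+ k.
have QE : 'X^(m.+1) %| (Q \Po phi) * W ^+ k - E.
  have -> : (Q \Po phi) * W ^+ k - E = (V * W) ^+ k - 1.
    by rewrite /E /D exprMn; ring.
  exact: dvdp_expr1B.
have QEs : 'X^(m.+1) %| ((Q \Po phi) * W ^+ k) ^+ s - E ^+ s.
  by rewrite subrXX dvdp_mulr.
pose Z := W ^+ t.+1 * (V + 'X * V^`()) * (gL \Po phi).
have cvE : rho%:C%C ^+ m * (Q ^+ s * gL)`_m = (E ^+ s * W ^+ t.+1 * (V + 'X * V^`()) * (gL \Po phi))`_m.
  rewrite -cv.
  rewrite (_ : E ^+ s * _ * _ * _ = E ^+ s * Z); last by rewrite /Z; ring.
  rewrite -(coef_modXnM Z QEs)//; apply: (congr1 (fun p : {poly R[i]} => p`_m)).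
  rewrite comp_polyM rmorphXn /= /Z (_ : m.+1 = (k * s + t.+1)%N); last by rewrite /m addnS.
  by rewrite exprD exprM exprMn; ring.
have Ks0 : 0 <= X * n.+1%:R * m.+1%:R ^+ 2 * M * (4 * (1 + B0)) ^+ n.
  by rewrite !mulr_ge0 ?exprn_ge0// mulr_ge0// addr_ge0.
(* The factor z^i of the twist becomes phi^i, of norm at most 4^i; the 1 in 4 (1 + [B0]) makes the
   base at least 1, so that i can be raised to n. *)
have gLb j : (j <= m)%N -> normc (gL \Po phi)`_j <= X * n.+1%:R * m.+1%:R ^+ 2 * M * (4 * (1 + B0)) ^+ n.
  move=> jm; rewrite /gL rmorph_sum /= coef_sum.
  apply: le_trans (ler_normc_sum _ _ _) _.
  apply: (@le_trans _ _ (\sum_(i < n.+1) X * (m.+1%:R ^+ 2 * M * (4 * (1 + B0)) ^+ n))); last first.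
    rewrite sumr_const card_ord -[leLHS]mulr_natl le_eqVlt; apply/orP; left; apply/eqP; ring.
  apply: ler_sum => i _; rewrite comp_polyZ coefZ normcM.
  apply: ler_pM; rewrite ?normc_ge0//.
  rewrite comp_polyM rmorphXn /= comp_polyX.
  have Kp : 0 <= m.+1%:R ^+ 2 * M * B0 ^+ i by rewrite !mulr_ge0 ?exprn_ge0.
  apply: le_trans (normc_coefM_le _ Kp _) _.
    by move=> l lj; apply: FP; [rewrite -ltnS|exact: leq_trans jm].
  have p4 : wnorm 1 (phi ^+ i) <= 4 ^+ i by apply: wnorm_exp_le.
  apply: le_trans (ler_wpM2r Kp p4) _.
  rewrite mulrCA ler_wpM2l ?mulr_ge0 ?exprn_ge0// -exprMn.
  have b1 : 4 * B0 <= 4 * (1 + B0) by lra.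
  apply: (@le_trans _ _ ((4 * (1 + B0)) ^+ i)).
    by rewrite lerXn2r// nnegrE ?mulr_ge0// addr_ge0.
  by rewrite ler_weXn2l//; [lra|rewrite -ltnS].
have nE : wnorm 1 (E ^+ s * W ^+ t.+1 * (V + 'X * V^`())) <= g1 ^+ s * 2 ^+ k.*2 * wnorm 1 (V + 'X * V^`()).
  apply: le_trans (wnormM _ _ ler01) _; rewrite ler_wpM2r//.
  apply: le_trans (wnormM _ _ ler01) _; apply: ler_pM; rewrite ?wnorm_ge0//.
    apply: wnorm_exp_le => //; rewrite /E /g1.
    apply: le_trans (wnormD _ _ ler01) _; rewrite wnorm1 lerD2l.
    apply: le_trans (wnormM _ _ ler01) _; rewrite [leRHS]mulrA.
    by apply: ler_pM; rewrite ?wnorm_ge0//; exact: wnorm_exp_le.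
  apply: (@le_trans _ _ (2 ^+ t.+1)); first exact: wnorm_exp_le.
  by rewrite ler_weXn2l// ler1n.
have fin : rho ^+ m * normc (Q ^+ s * gL)`_m <=
   g1 ^+ s * 2 ^+ k.*2 * wnorm 1 (V + 'X * V^`()) * (X * n.+1%:R * m.+1%:R ^+ 2 * M * (4 * (1 + B0)) ^+ n).
  have -> : rho ^+ m * normc (Q ^+ s * gL)`_m = normc (rho%:C%C ^+ m * (Q ^+ s * gL)`_m).
    by rewrite normcM normcX normc_real ger0_norm//; lra.
  rewrite cvE; apply: le_trans (normc_coefM_le _ Ks0 gLb) _.
  by rewrite ler_wpM2r.
have rks : rho ^+ (k * s) <= rho ^+ m by rewrite ler_weXn2l// leq_addr.
have rks0 : 0 < rho ^+ (k * s) by rewrite exprn_gt0//; lra.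
rewrite expr_div_n -exprM mulrA ler_pdivlMr// mulrC.
apply: le_trans (ler_wpM2r (normc_ge0 _) rks) _.
apply: le_trans fin _; rewrite le_eqVlt; apply/orP; left; apply/eqP; ring.
Qed.

End HankelEstimate.

(** * Choice of parameters *)

Section Asymptotics.
Variable R : realType.

Lemma succ_le_expr (l : R) : 1 < l -> exists N0, forall N, (N0 <= N)%N -> N.+1%:R <= l ^+ N.
Proof.
move=> l1; pose x := l - 1; have x0 : 0 < x by rewrite subr_gt0.
pose j0 := (Num.truncn (3 / x ^+ 2)).+1.
have j0P : 3 <= j0%:R * x ^+ 2.
  rewrite -ler_pdivrMr ?exprn_gt0//; apply: ltW; exact: truncnS_gt.
exists j0.*2 => N NN; pose j := N./2.
have jj : (j0 <= j)%N by rewrite /j -(doubleK j0) half_leq.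
have jP : 3 <= j%:R * x ^+ 2.
  by apply: le_trans j0P _; rewrite ler_wpM2r ?exprn_ge0 ?(ltW x0)// ler_nat.
have j1 : 1 <= j%:R :> R by rewrite ler1n (leq_trans _ jj).
have b : 1 + j%:R * x <= l ^+ j.
  by have := bernoulli_le j (ltW x0); rewrite (_ : 1 + x = l)// /x addrC subrK.
have b0 : 0 <= j%:R * x by rewrite mulr_ge0// ltW.
apply: (@le_trans _ _ (l ^+ (j * 2))); last first.
  by rewrite ler_weXn2l ?(ltW l1)// /j; lia.
apply: (@le_trans _ _ (2 * j%:R + 2)).
  rewrite -natrM -natrD ler_nat /j; lia.
rewrite exprM; apply: (@le_trans _ _ ((1 + j%:R * x) ^+ 2)); first by nra.
by rewrite lerXn2r// nnegrE; lra.
Qed.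

Lemma const_le_expr (l A : R) : 1 < l -> exists N0, forall N, (N0 <= N)%N -> A <= l ^+ N.
Proof.
move=> l1; have [N0 N0P] := succ_le_expr l1.
exists (maxn N0 (Num.truncn A).+1) => N; rewrite geq_max => /andP[h1 h2].
apply: le_trans (N0P N h1); apply: ltW; apply: lt_le_trans (truncnS_gt A) _.
by rewrite ler_nat ltnW.
Qed.

Lemma one_sub_expr_ge (y : R) n : 0 <= y <= 1 -> 1 - n%:R * y <= (1 - y) ^+ n.
Proof.
move=> /andP[y0 y1]; elim: n => [|n IH]; first by rewrite mul0r subr0 expr0.
rewrite exprS; have h := ler_wpM2l (_ : 0 <= 1 - y) IH.
apply: le_trans (h _); last by lra.
by have n0 : 0 <= n%:R :> R by []; rewrite -natr1; nra.
Qed.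

(** With (n + 2) y = 1 - theta and l = 1/(1 - y), Bernoulli's inequality gives l^-n >= 1 - n y >=
    theta. *)
Lemma small_base (theta : R) n : 0 <= theta < 1 ->
  exists2 l : R, 1 < l & l ^+ n * theta <= 1.
Proof.
move=> /andP[t0 t1]; pose y : R := (1 - theta) / n.+2%:R.
have y0 : 0 < y by rewrite divr_gt0// subr_gt0.
have yE : y * n.+2%:R = 1 - theta by rewrite divfK// pnatr_eq0.
have n0 : 0 <= n%:R :> R by [].
have nE : n.+2%:R = n%:R + 2 :> R by rewrite -addn2 natrD.
rewrite nE in yE; have ny : 0 <= n%:R * y by rewrite mulr_ge0// ltW.
have y1 : y < 1 by nra.
have p : 0 < 1 - y by rewrite subr_gt0.
exists (1 - y)^-1; first by rewrite invf_gt1//; lra.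
rewrite exprVn mulrC ler_pdivrMr ?exprn_gt0// mul1r.
by apply: le_trans (one_sub_expr_ge n _); [|apply/andP; split]; lra.
Qed.

Lemma zero_densityP (S : set nat) (eta : R) : zero_density R S -> 0 < eta ->
  exists N0, forall N, (N0 <= N)%N ->
    (\sum_(1 <= i < N.+1 | i \in S) 1)%N%:R <= eta * N%:R.
Proof.
move=> S0 eta0; have : (limn_esup (fun n : nat =>
    ((\sum_(1 <= i < n.+1 | i \in S) 1)%N%:R / n%:R : R)%:E) < eta%:E)%E.
  by rewrite S0 lte_fin.
rewrite /limn_esup /limf_esup => /ereal_inf_lt[y [A [N0 _ AN0] <-]] lt.
exists N0.+1 => N NN.
have h : ((((\sum_(1 <= i < N.+1 | i \in S) 1)%N%:R / N%:R : R)%:E) <= eta%:E)%E.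
  apply: le_trans (ltW lt); apply: ereal_sup_ubound; exists N => //.
  by apply: AN0 => /=; exact: ltnW.
by move: h; rewrite lee_fin ler_pdivrMr// ltr0n (leq_trans _ NN).
Qed.

(** C(j, i) (l - 1)^i is one term of the expansion of l^j. The growth in N is as slow as desired;
    the large base of the power n is harmless when n is a small multiple of N. *)
Lemma bin_le_expr (l : R) j i N n : 1 < l -> (j <= N)%N -> (i <= n)%N ->
  'C(j, i)%:R <= l ^+ N * (1 + (l - 1)^-1) ^+ n.
Proof.
move=> l1 jN iN; have x0 : 0 < l - 1 by rewrite subr_gt0.
case: (leqP i j) => ij; last first.
  rewrite bin_small// mulr_ge0// ?exprn_ge0 ?addr_ge0 ?invr_ge0 ?(ltW x0)//; lra.
have := @bin_mul_expr_le R (l - 1) 1 i (j - i) (ltW x0) ler01.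
rewrite expr1n mulr1 subrK subnKC// -ler_pdivlMr ?exprn_gt0// => /le_trans; apply.
apply: ler_pM; rewrite ?exprn_ge0 ?invr_ge0 ?exprn_ge0 ?(ltW x0)//; first by lra.
  by rewrite ler_weXn2l// ltW.
rewrite -exprVn; apply: (@le_trans _ _ ((1 + (l - 1)^-1) ^+ i)).
  by rewrite lerXn2r// ?nnegrE ?addr_ge0 ?invr_ge0 ?(ltW x0)// lerDr.
by rewrite ler_weXn2l// lerDl invr_ge0 ltW.
Qed.

End Asymptotics.

(** * From small Hankel determinants to rational approximation *)

Section Vanishing.
Variable R : realType.

Lemma ratr_complex (x : rat) : ratr x = (ratr x : R)%:C%C :> R[i].
Proof. by rewrite -(fmorph_eq_rat (real_complex R \o ratr)). Qed.

Lemma normc_ratr (x : rat) : normc (ratr x : R[i]) = ratr `|x|.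
Proof. by rewrite ratr_complex normc_real ratr_norm. Qed.

Lemma hankel_vanishes (g : nat -> rat) (Q : {poly R[i]}) k d n N (K theta : R) :
  (0 < k)%N -> Q`_0 = 1 -> (size Q <= k.+1)%N -> 0 <= K -> 0 <= theta <= 1 ->
  (0 < d)%N -> (0 < n)%N -> (n.*2 <= N)%N ->
  (forall i, (i <= N)%N -> d%:R * g i \is a Num.int) ->
  (forall s t, (t < k.*2)%N -> (k * s + t <= N)%N ->
    normc (moment (fun c => ratr (g (k * s + t - c)%N)) (Q ^+ s)) <= K * theta ^+ s) ->
  d%:R * (n%:R * K * theta ^+ (n %/ k.*2)) < 1 ->
  \det (hankel g n) = 0.
Proof.
move=> k0 Q0 sQ K0 tE d0 n0 nN dg gQ small.
apply: (det_hankel_int0 d0) => [i i2|]; first by apply: dg; exact: leq_trans nN.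
have b : normc (\det (hankel (fun i => ratr (g i) : R[i]) n))
    <= (n%:R * K * theta ^+ (n %/ k.*2)) ^+ n.
  apply: (det_hankel_bound k0 Q0 sQ K0 tE) => s t tk st.
  by apply: gQ => //; exact: leq_trans nN.
have hE : hankel (fun i => ratr (g i) : R[i]) n = map_mx ratr (hankel g n).
  by apply/matrixP => i j; rewrite !mxE.
rewrite hE det_map_mx normc_ratr in b.
have /andP[t0 t1] := tE.
rewrite -(ltr_rat R) rmorph1 rmorphM rmorphXn /= ratr_nat.
apply: le_lt_trans (ler_wpM2l _ b) _; first by rewrite exprn_ge0.
rewrite -exprMn exprn_ilt1 ?mulr_ge0 ?exprn_ge0// -?lt0n//.
Qed.

End Vanishing.

(** The determinant of order 0 is 1, so there is a largest r <= m with nonzero determinant; by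
    maximality and hypothesis the orders from r + 1 to M all vanish, as [hankel_recurrence]
    requires. *)
Lemma vanishing_hankel_pade (g : nat -> rat) m M : (m <= M)%N ->
  (forall n, (m <= n <= M)%N -> \det (hankel g n) = 0) ->
  exists u v : {poly rat},
    [/\ (size u <= m.+1)%N, (size v <= m.+1)%N, coprimep u v, v.[0] != 0 &
     forall j, (j < M)%N -> g j = quot_series u v j].
Proof.
move=> mM gM; pose p r := (r <= m)%N && (\det (hankel g r) != 0).
have ex : exists r, p r by exists 0%N; rewrite /p det_mx00 oner_eq0.
have pm r : p r -> (r <= m)%N by case/andP.
case: (ex_maxnP ex pm) => r /andP[rm Hr] rmax.
have [|q [mq sq qM]] := @hankel_recurrence _ g r M Hr.
  move=> n /andP[rn nM]; case: (leqP m n) => mn; first by rewrite gM// mn.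
  apply/eqP; apply: contraTT rn => Hn; rewrite -leqNgt; apply: rmax.
  by rewrite /p ltnW.
have [u [v [su sv cuv v0 guv]]] := recurrence_quot_series mq sq qM.
exists u, v; split => //; first exact: leq_trans su _.
exact: leq_trans sv _.
Qed.

Lemma biglcm_den_dvd (a : nat -> rat) (S : set nat) N i : (i <= N)%N -> i \notin S ->
  (den (a i) %| \big[lcmn/1%N]_(0 <= j < N.+1 | j \notin S) den (a j))%N.
Proof.
move=> iN iS; rewrite big_mkord.
by rewrite (@biglcmn_sup _ (Ordinal (iN : (i < N.+1)%N))).
Qed.

Lemma biglcm_den_gt0 (a : nat -> rat) (S : set nat) N :
  (0 < \big[lcmn/1%N]_(0 <= j < N.+1 | j \notin S) den (a j))%N.
Proof.
elim/big_ind: _ => // [x y x0 y0|i _]; first by rewrite lcmn_gt0 x0.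
by rewrite /den; case: ex_minnP => e /andP[].
Qed.

Lemma twisted_den_int (a : nat -> rat) (S : set nat) (P : {poly rat}) N :
  integer_valued P -> (forall j, (j <= N)%N -> j \in S -> P.[j%:R] = 0) ->
  forall j, (j <= N)%N ->
  (\big[lcmn/1%N]_(0 <= i < N.+1 | i \notin S) den (a i))%:R * (P.[j%:R] * a j)
    \is a Num.int.
Proof.
move=> Pint PS j jN; case: (boolP (j \in S)) => jS.
  by rewrite PS// mul0r mulr0.
rewrite mulrCA rpredM//; first by have := Pint j; rewrite -pmulrn.
by apply: den_mul_int; exact: biglcm_den_dvd.
Qed.

Lemma ord_ge (R : realType) (g : nat -> rat) M : (forall j, (j < M)%N -> g j = 0) ->
  ((M%:R : R)%:E <= ord R g)%E.
Proof.
move=> g0; apply: le_ereal_inf_tmp => _ [j gj <-]; rewrite lee_fin ler_nat leqNgt.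
by apply/negP => /g0 /eqP; exact/negP.
Qed.

Lemma normc_int (R : realType) (z : int) : normc (z%:~R : R[i]) = `|z|%N%:R.
Proof.
case: z => n; first by rewrite -pmulrn normc_nat.
by rewrite NegzE mulrNz normcN -pmulrn normc_nat.
Qed.

Theorem theorem3p3 (R : realType) (a : nat -> rat)
    (a_cvg : forall z : complexes R,
       `|z| < 1 -> cvgn (power_series (complex_coefs R a) z)) :
  [\/ unit_circle_natural_boundary (sum_fun (complex_coefs R a)),
      exists2 beta : R, 1 < beta &
        forall S : set nat, zero_density R S ->
          \forall n \near \oo,
            beta ^+ n <
            (\big[lcmn/1%N]_(0 <= i < n.+1 | i \notin S) den (a i))%:R
    | forall B : R, 0 < B ->
        exists (n : nat) (P u v : {poly rat}),
          [/\ [/\ (0 < n)%N, P != 0, integer_valued P & (size P <= n.+1)%N],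
              [/\ (size u <= n.+1)%N, (size v <= n.+1)%N, coprimep u v
                & v.[0] != 0]
            & ((B * n%:R)%R%:E <
               ord R (fun j => (P.[j%:R] * a j - quot_series u v j)%R))%E]].
Proof.
have [?|notNB] := pselect (unit_circle_natural_boundary (sum_fun (complex_coefs R a))).
  exact: Or31.
set goal2 := (X in or3 _ X _).
have [?|not2] := pselect goal2; first exact: Or32.
apply: Or33 => b b0.
have [w [w1 wc]] : exists w : R[i], normc w = 1 /\
    continuable_at (sum_fun (complex_coefs R a)) w.
  apply: contrapT => h; apply: notNB => w w1 wc; apply: h; exists w; split => //.
  by apply: complexI; rewrite -normr_normc; exact: w1.
pose alpha : nat -> R[i] := complex_coefs R a.
have [k [Q [theta [A [B [[k0 Q0 sQ tE [A0 B1]] est]]]]]] :=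
  hankel_estimate w1 (cvg_disk_bounded a_cvg) (continuable_continues a_cvg wc).
have [theta0 theta1] := andP tE.
pose bn := (Num.truncn b).+1.
have bbn : b <= bn%:R by apply: ltW; exact: truncnS_gt.
(* The degree bound will be m0 = 2k (N / h), so that b m0 <= N/4 stays below the order of agreement
   N/2. *)
pose h := (k.*2 * (4 * bn))%N.
have h0 : (0 < h)%N by rewrite !muln_gt0 double_gt0 k0.
(* The final bound is l^(10 N) theta^e with e = N / h; since N < 2 h e, the exponent 20 h makes it
   smaller than 1. *)
have [l l1 lh] := small_base (20 * h) tE.
have l0 : 0 < l by lra.
pose y : R := 1 + (l - 1)^-1.
have y1 : 1 <= y by rewrite lerDl invr_ge0 subr_ge0 ltW.
have [N1 N1P] := succ_le_expr l1.
have [N2 N2P] := const_le_expr A l1.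
have [N3 N3P] := const_le_expr B l1.
have [N4 N4P] := const_le_expr y l1.
(* P will have degree at most N / h', so that B^n and y^n are at most l^N. *)
pose h' := maxn h (maxn N3 N4).
have hh' : (h <= h')%N by rewrite leq_maxl.
have Bh : B <= l ^+ h' by rewrite N3P// !leq_max leqnn !orbT.
have yh : y <= l ^+ h' by rewrite N4P// !leq_max leqnn !orbT.
have h'0 : (0 < h')%N by exact: leq_trans hh'.
(* The base l depends only on f and b; the second alternative fails for it. *)
have [S [S0 SP]] : exists S : set nat, zero_density R S /\
    ~ \forall n \near \oo, l ^+ n <
       (\big[lcmn/1%N]_(0 <= i < n.+1 | i \notin S) den (a i))%:R.
  apply: contrapT => H; apply: not2; exists l => // S S0.
  by apply: contrapT => H'; apply: H; exists S.
(* At most N/(8 h') elements of S in [1, N], together with 0, which the density ignores, number at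
   most n/2 once N >= 8 h'. *)
have eta0 : 0 < ((8 * h')%:R)^-1 :> R by rewrite invr_gt0 ltr0n muln_gt0.
have [N5 N5P] := zero_densityP S0 eta0.
have [NN [NN1 NN2 NN5 NNh]] : exists NN, [/\ N1 <= NN, N2 <= NN, N5 <= NN & 8 * h' <= NN]%N.
  by exists (maxn (maxn N1 N2) (maxn N5 (8 * h'))); rewrite !leq_max !leqnn !orbT.
have [N [NNN dN]] : exists N, (NN <= N)%N /\
    (\big[lcmn/1%N]_(0 <= i < N.+1 | i \notin S) den (a i))%:R <= l ^+ N.
  apply: contrapT => H; apply: SP; exists NN => // N /= hN.
  by rewrite ltNge; apply/negP => hd; apply: H; exists N.
set d := \big[lcmn/1%N]_(_ <= i < _ | _) _ in dN.
have d0 : (0 < d)%N by exact: biglcm_den_gt0.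
(* Orders from m0 to M will vanish: up to M only indices up to N occur, and from m0 on the exponent
   of theta is at least N / h. *)
pose n := (N %/ h')%N; pose m0 := (k.*2 * (N %/ h))%N; pose M := N./2.
pose A1 := Num.truncn (l ^+ N * y ^+ n).
have A1P j i : (j <= N)%N -> (i <= n)%N -> ('C(j, i) <= A1)%N.
  move=> jN iN; rewrite truncn_ge_nat; first exact: bin_le_expr.
  by rewrite mulr_ge0 ?exprn_ge0 ?(ltW l0)//; lra.
have y0 : 0 <= y by lra.
have A10 : (0 < A1)%N.
  by rewrite truncn_gt0 mulr_ege1// exprn_ege1// ltW.
have nN' : (h' * n <= N)%N by rewrite mulnC leq_trunc_div.
have A1l : A1%:R <= l ^+ N * l ^+ N.
  apply: (@le_trans _ _ (l ^+ N * y ^+ n)).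
    by rewrite truncn_le mulr_ge0 ?exprn_ge0 ?(ltW l0).
  rewrite ler_wpM2l ?exprn_ge0 ?(ltW l0)//.
  apply: (@le_trans _ _ ((l ^+ h') ^+ n)).
    by rewrite lerXn2r// nnegrE ?exprn_ge0 ?(ltW l0).
  by rewrite -exprM ler_weXn2l// ltW.
move: NN1 NN2 NN5 NNh => /leq_trans/(_ NNN) NN1 /leq_trans/(_ NNN) NN2.
move=> /leq_trans/(_ NNN) NN5 /leq_trans/(_ NNN) NNh.
have Sn : ((\sum_(0 <= i < N.+1 | i \in S) 1).*2 <= n)%N.
  rewrite big_ltn_cond//; set c1 := (\sum_(1 <= i < N.+1 | i \in S) 1)%N.
  have c1N : (c1 * (8 * h') <= N)%N.
    have := N5P N NN5; rewrite -/c1 mulrC ler_pdivlMr ?ltr0n ?muln_gt0//.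
    by rewrite -natrM ler_nat.
  rewrite /n leq_divRL//; apply: (@leq_trans ((1 + c1).*2 * h')).
    by rewrite leq_mul2r leq_double; case: ifP => _; rewrite ?leqnn ?leq_addl ?orbT.
  by clear -c1N NNh; nia.
have [c [P [cA P0 Pint sP [PE PS]]]] := vanishing_integer_valued Sn A10 A1P.
pose g j : rat := P.[j%:R] * a j.
have gE j : ratr (g j) = binomial_twist alpha (fun i => (c i)%:~R) n j.
  rewrite /g rmorphM /= PE rmorph_sum /= mulr_suml; apply: eq_bigr => i _.
  by rewrite rmorphM /= ratr_int ratr_nat -mulrA mulr_natl.
pose X : R := (n.+1 * A1)%:R.
have cX i : normc ((c i)%:~R : R[i]) <= X by rewrite normc_int ler_nat.
pose K : R := A * B ^+ n * X * n.+1%:R * N.+1%:R ^+ 2.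
have B0 : 0 <= B by lra.
have X0 : 0 <= X by [].
have K0 : 0 <= K by rewrite !mulr_ge0 ?exprn_ge0.
have gQ s t : (t < k.*2)%N -> (k * s + t <= N)%N ->
    normc (moment (fun i => ratr (g (k * s + t - i)%N)) (Q ^+ s)) <= K * theta ^+ s.
  move=> tk st; rewrite [X in moment X _](_ : _ = (fun i =>
      binomial_twist alpha (fun i => (c i)%:~R) n (k * s + t - i)%N)); last first.
    by apply/funext => i; rewrite gE.
  apply: le_trans (est n _ X cX s t tk) _.
  rewrite ler_wpM2r ?exprn_ge0// ler_wpM2l ?mulr_ge0 ?exprn_ge0//.
  by rewrite lerXn2r ?nnegrE// ler_nat ltnS.
pose e := (N %/ h)%N.
have e0 : (0 < e)%N.
  by rewrite divn_gt0//; apply: leq_trans hh' _; apply: leq_trans NNh; rewrite leq_pmull.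
have Nh : (N < h * e.+1)%N by rewrite mulnC ltn_ceil.
have LT : l ^+ (10 * N) * theta ^+ e < 1.
  have t1 : l ^+ (20 * h * e) * theta ^+ e <= 1.
    by rewrite exprM -exprMn exprn_ile1// mulr_ge0// exprn_ge0// ltW.
  have t2 : l ^+ (10 * N) < l ^+ (20 * h * e) by rewrite ltr_eXn2l//; clear -Nh e0; nia.
  have [->|te] := eqVneq (theta ^+ e) 0; first by rewrite mulr0.
  by apply: lt_le_trans t1; rewrite ltr_pM2r// lt_def te exprn_ge0.
have l_ge0 : 0 <= l ^+ N by rewrite exprn_ge0// ltW.
have nl : n.+1%:R <= l ^+ N.
  by apply: le_trans (N1P N NN1); rewrite ler_nat ltnS leq_div.
(* The factors bound A, B^n, X, n + 1 and (N + 1)^2 in this order; X takes three of them, two for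
   [A1]. *)
have Kl : K <= l ^+ N * l ^+ N * (l ^+ N * (l ^+ N * l ^+ N)) * l ^+ N * (l ^+ N) ^+ 2.
  apply: ler_pM; rewrite ?mulr_ge0 ?exprn_ge0//; last first.
    by rewrite lerXn2r ?nnegrE// N1P.
  apply: ler_pM; rewrite ?mulr_ge0 ?exprn_ge0//.
  apply: ler_pM; rewrite ?mulr_ge0 ?exprn_ge0//; last first.
    by rewrite /X natrM; apply: ler_pM.
  apply: ler_pM; rewrite ?exprn_ge0//; first exact: N2P.
  apply: (@le_trans _ _ ((l ^+ h') ^+ n)).
    by rewrite lerXn2r// nnegrE ?exprn_ge0 ?(ltW l0).
  by rewrite -exprM ler_weXn2l// ltW.
have m0N : (m0 * (4 * bn) <= N)%N.
  by rewrite /m0 mulnAC -/h mulnC leq_trunc_div.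
have bn1 : (1 <= bn)%N by [].
have m0M : (m0 <= M)%N by rewrite /M; clear -m0N bn1; nia.
have m00 : (0 < m0)%N by rewrite muln_gt0 double_gt0 k0.
have gdet n' : (m0 <= n' <= M)%N -> \det (hankel g n') = 0.
  move=> /andP[mn nM].
  have n0 : (0 < n')%N by exact: leq_trans mn.
  have nN : (n'.*2 <= N)%N by clear -nM; rewrite /M in nM; lia.
  have tE' : 0 <= theta <= 1 by rewrite theta0 ltW.
  apply: (hankel_vanishes (K := K) k0 Q0 sQ K0 tE' d0 n0 nN _ gQ).
    by move=> i iN; apply: twisted_den_int.
  apply: le_lt_trans LT.
  have en : (e <= n' %/ k.*2)%N by rewrite leq_divRL ?double_gt0// mulnC.
  have n'l : n'%:R <= l ^+ N.
    by apply: le_trans (N1P N NN1); rewrite ler_nat; clear -nN; lia.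
  (* One factor l^N bounds d, one n' and eight K, ten in all. *)
  apply: (@le_trans _ _ (l ^+ N * (l ^+ N * (l ^+ N * l ^+ N * (l ^+ N * (l ^+ N * l ^+ N))
      * l ^+ N * (l ^+ N) ^+ 2) * theta ^+ e))).
    apply: ler_pM; rewrite ?mulr_ge0 ?exprn_ge0//.
    apply: ler_pM; rewrite ?mulr_ge0 ?exprn_ge0//; last first.
      by rewrite ler_wiXn2l// ltW.
    exact: ler_pM.
  rewrite [(10 * N)%N]mulnC exprM le_eqVlt; apply/orP; left; apply/eqP; ring.
have [u [v [su sv cuv v0 guv]]] := vanishing_hankel_pade m0M gdet.
exists m0, P, u, v; split; [split => //|split => //|].
  apply: leq_trans sP _; rewrite ltnS /n /m0.
  apply: (@leq_trans (N %/ h)); first exact: leq_div2l.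
  by rewrite leq_pmull// double_gt0.
apply: (@lt_le_trans _ _ (M%:R)%:E); last first.
  by apply: ord_ge => j jM; rewrite -guv// subrr.
rewrite lte_fin; apply: (@le_lt_trans _ _ (bn * m0)%:R).
  by rewrite natrM ler_wpM2r.
by rewrite ltr_nat /M; clear -m0N bn1 m00; nia.
Qed.
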